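(* Let $\mathcal{D}\subset\mathbb{R}^N$ be an open, bounded domain. Given a bounded and uniformly continuous datum $F:\mathbb{R}^N\to\mathbb{R}$, there exists at most one viscosity solution $u$ to the Dirichlet problem $$\tilde{\mathcal{L}}_{s,\mathbf p}[u]=0\ \text{ in }\mathcal{D},\qquad u=F\ \text{ in }\mathbb{R}^N\setminus\mathcal{D}.$$
   Context: Fix an integer $N\ge 2$, $\mathbf p\in[2,\infty)$ and $s\in(\frac12,1)$. $B_r(x)$ is the open ball, $e_1,e_2,\dots$ the standard basis of $\mathbb{R}^N$, $\angle(y,z)$ the angle between vectors. $\mathrm{d}\mu_s^N(z)=\frac{C(N,s)}{|z|^{N+2s}}\,\mathrm{d}z$ with $C(N,s)=\frac{4^s s\,\Gamma(\frac N2+s)}{\pi^{N/2}\Gamma(1-s)}$. Let $\alpha_{\mathbf p}\in(0,\frac\pi2]$ be the angle such that, with $A_{\mathbf p}=\{|z|=1:\ \angle(e_1,z)<\alpha_{\mathbf p}\}$ and $\sigma$ the surface measure on the unit sphere, $\mathbf p-1=\int_{A_{\mathbf p}}\langle z,e_1\rangle^2\,\mathrm{d}\sigma(z)\big/\int_{A_{\mathbf p}}\langle z,e_2\rangle^2\,\mathrm{d}\sigma(z)$. For $0\le a\le b\le\infty$ and $|y|=1$ let $T_{\mathbf p}^{a,b}(y)=\{z\in\mathbb{R}^N:\ \angle(y,z)<\alpha_{\mathbf p},\ a<|z|<b\}$. For unit vectors $y\ne\tilde y$, $R_{\tilde y,y}\in SO(N)$ is the orientation preserving rotation in the plane spanned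 by $y,\tilde y$ with $R_{\tilde y,y}y=\tilde y$; $R_{y,y}=Id_N$; for $\tilde y=-y$ fix any rotation in $SO(N)$ mapping $y$ to $-y$. A function $u$ is in $C^{1,1}(x)$ if there are $p_x\in\mathbb{R}^N$ and $C_x,r_x>0$ with $|u(x+z)-u(x)-\langle p_x,z\rangle|\le C_x|z|^2$ for all $|z|<r_x$. For a bounded Borel $u\in C^{1,1}(x)$ define $$\tilde{\mathcal{L}}_{s,\mathbf p}[u](x)=\sup_{|y|=1}\inf_{|\tilde y|=1}\int_{T_{\mathbf p}^{0,\infty}(y)}\big(u(x+z)+u(x-R_{\tilde y,y}z)-2u(x)\big)\,\mathrm{d}\mu_s^N(z),$$ where the integral (absolutely convergent when $p_x=0$) is understood as the limit in $[-\infty,\infty]$, as $\epsilon\to0+$, of the same integral over $T_{\mathbf p}^{\epsilon,\infty}(y)$. Viscosity notions: a bounded, uniformly continuous $u:\mathbb{R}^N\to\mathbb{R}$ is a viscosity subsolution of $\tilde{\mathcal{L}}_{s,\mathbf p}[u]=0$ in $\mathcal{D}$ if for every $x\in\mathcal{D}$, $r>0$ and $\phi\in C^2(\mathbb{R}^N)$ with $\phi(x)=u(x)$ and $\phi>u$ on $\bar B_r(x)\setminus\{x\}$ one has $\tilde{\mathcal{L}}_{s,\mathbf p}[\mathbf 1_{\bar B_r(x)}\phi+\mathbf 1_{\mathbb{R}^N\setminus\bar B_r(x)}u](x)\ge0$ (no condition $\nabla\phi(x)\ne0$ is required). $u$ is a viscosity supersolution if $-u$ is a viscosity subsolution. A viscosity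 solution of the Dirichlet problem is a function that is both a viscosity subsolution and supersolution and equals $F$ in $\mathbb{R}^N\setminus\mathcal{D}$. *)

(* Defs.v *)
(* The space R^N is 'rV[R]_N.  Its library topology,
   uniformity and norm are those of the sup norm: they give the usual notions of
   open and bounded set and of uniform continuity, but metric quantities must go
   through the Euclidean norm [enorm] below. *)
From HB Require Import structures.
From mathcomp Require Import all_boot all_order all_algebra.
From mathcomp Require Import all_classical all_reals all_analysis.
From mathcomp Require Import measurable_realfun.

Set Implicit Arguments.
Unset Strict Implicit.
Unset Printing Implicit Defensive.

Import Order.TTheory GRing.Theory Num.Theory.
Import numFieldNormedType.Exports.

Local Open Scope classical_set_scope.
Local Open Scope ring_scope.

Fact measure_rV_display : measure_display.
Proof. exact: (default_measure_display). Qed.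

(* The product sigma-algebra on R^n, i.e. the Borel sigma-algebra, defined as
   the library does for tuples. *)
Section measurable_rV.
Context {R : realType} (n : nat).

Let coors : 'I_n -> 'rV[R]_n -> measurableTypeR R := fun i x => x ord0 i.

Let rV_set0 : g_sigma_preimage coors set0.
Proof. exact: sigma_algebra0. Qed.

Let rV_setC A : g_sigma_preimage coors A -> g_sigma_preimage coors (~` A).
Proof. exact: sigma_algebraC. Qed.

Let rV_bigcup (F : (set 'rV[R]_n)^nat) :
  (forall i, g_sigma_preimage coors (F i)) ->
  g_sigma_preimage coors (\bigcup_i (F i)).
Proof. exact: sigma_algebra_bigcup. Qed.

HB.instance Definition _ := @isMeasurable.Build measure_rV_display
  'rV[R]_n (g_sigma_preimage coors) rV_set0 rV_setC rV_bigcup.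

End measurable_rV.

Lemma measurable_coord_rV (R : realType) n (i : 'I_n) :
  measurable_fun [set: 'rV[R]_n]
    (fun x : 'rV[R]_n => x ord0 i : measurableTypeR R).
Proof.
move=> _ Y mY; rewrite setTI; apply: sub_sigma_algebra => /=.
rewrite -bigcup_seq/=; exists i => /=; first by rewrite mem_index_enum.
by exists Y => //; rewrite setTI.
Qed.

Lemma measurable_fun_rVP (R : realType) d (T : measurableType d) n
    (f : T -> 'rV[R]_n) :
  measurable_fun [set: T] f <->
  forall i, measurable_fun [set: T] (fun x => f x ord0 i : measurableTypeR R).
Proof.
split=> [mf i|mf].
  exact: (measurableT_comp (measurable_coord_rV i) mf).
apply: measurability => [//|_ [A + <-]].
rewrite -bigcup_seq => -[i _ [B mB <-]]; rewrite !setTI.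
by rewrite -[X in measurable X]setTI; exact: mf.
Qed.

Definition cons_rV (R : realType) n (q : measurableTypeR R * 'rV[R]_n) :
  'rV[R]_(1 + n) := row_mx (q.1)%:M q.2.

Lemma cons_rVl (R : realType) n (q : measurableTypeR R * 'rV[R]_n) (i : 'I_1) :
  cons_rV q ord0 (@lshift 1 n i) = q.1.
Proof. by rewrite /cons_rV row_mxEl (ord1 i) mxE eqxx mulr1n. Qed.

Lemma cons_rVr (R : realType) n (q : measurableTypeR R * 'rV[R]_n) (i : 'I_n) :
  cons_rV q ord0 (@rshift 1 n i) = q.2 ord0 i.
Proof. by rewrite /cons_rV row_mxEr. Qed.

Lemma measurable_cons_rV (R : realType) n :
  measurable_fun [set: measurableTypeR R * 'rV[R]_n] (@cons_rV R n).
Proof.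
apply/measurable_fun_rVP => i; rewrite -(splitK i).
case: (fintype.split i) => j /=.
  rewrite (_ : (fun x : measurableTypeR R * 'rV[R]_n => _) = fst) //.
  by apply/funext => q; rewrite cons_rVl.
rewrite (_ : (fun x : measurableTypeR R * 'rV[R]_n => _) =
    (fun x => x.2 ord0 j)); last first.
  by apply/funext => q; rewrite cons_rVr.
exact: (measurableT_comp (measurable_coord_rV j) measurable_snd).
Qed.

Lemma measurable_head_rV (R : realType) n :
  measurable_fun [set: 'rV[R]_(1 + n)]
    (fun x : 'rV[R]_(1 + n) =>
       (x ord0 (lshift n ord0) : measurableTypeR R, rsubmx x)).
Proof.
apply: measurable_fun_pair; first exact: measurable_coord_rV.
apply/measurable_fun_rVP => i.
rewrite (_ : (fun _ => _) = (fun x : 'rV[R]_(1 + n) => x ord0 (rshift 1 i))).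
  exact: measurable_coord_rV.
by apply/funext => x; rewrite mxE.
Qed.

Section lebesgue_step.
Context (R : realType) (n : nat).
Variable mu : {sigma_finite_measure set 'rV[R]_n -> \bar R}.

Definition lebesgue_step : set 'rV[R]_(1 + n) -> \bar R :=
  pushforward (@lebesgue_measure R \x mu)%E (@cons_rV R n).

Let lebesgue_step0 : lebesgue_step set0 = 0%E.
Proof. by rewrite /lebesgue_step /pushforward preimage_set0 measure0. Qed.

Let lebesgue_step_ge0 A : (0 <= lebesgue_step A)%E.
Proof. by rewrite /lebesgue_step /pushforward measure_ge0. Qed.

Let lebesgue_step_sigma_additive : semi_sigma_additive lebesgue_step.
Proof.
exact: (@measure_semi_sigma_additive _ _ _
  (measure_function_pushforward__canonical__measure_function_Measure
     _ (@measurable_cons_rV R n))).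
Qed.

HB.instance Definition _ := isMeasure.Build _ _ _ lebesgue_step
  lebesgue_step0 lebesgue_step_ge0 lebesgue_step_sigma_additive.

Let lebesgue_step_sigma_finite : sigma_finite setT lebesgue_step.
Proof.
have /sigma_finiteP[F [FT ndF Foo]] := sigma_finiteT (@lebesgue_measure R).
have /sigma_finiteP[G [GT ndG Goo]] := sigma_finiteT mu.
pose h (x : 'rV[R]_(1 + n)) : measurableTypeR R * 'rV[R]_n :=
  (x ord0 (lshift n ord0), rsubmx x).
have hK : cancel (@cons_rV R n) h.
  by move=> [a v]; rewrite /h cons_rVl /cons_rV row_mxKr.
exists (fun k => h @^-1` (F k `*` G k)).
  rewrite -preimage_bigcup (_ : \bigcup_k _ = setT) ?preimage_setT//.
  rewrite -setXTT FT GT predeqE => -[x y]; split.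
    by move=> [k _ []/= ? ?]; split; exists k.
  move=> [/= [k _ Fkx] [l _ Gly]]; exists (maxn k l) => //; split.
  - by move: x Fkx; exact/subsetPset/ndF/leq_maxl.
  - by move: y Gly; exact/subsetPset/ndG/leq_maxr.
move=> k; have [? ?] := Foo k; have [? ?] := Goo k.
have mFG : measurable (F k `*` G k) by exact: measurableX.
split.
  by rewrite -[X in measurable X]setTI; exact: measurable_head_rV.
rewrite /lebesgue_step /pushforward -comp_preimage.
rewrite (_ : h \o _ = id) ?preimage_id; last exact/funext.
by rewrite product_measure1E// lte_mul_pinfty// ge0_fin_numE.
Qed.

HB.instance Definition _ := Measure_isSigmaFinite.Build _ _ _ lebesgue_step
  lebesgue_step_sigma_finite.

End lebesgue_step.


(* N-dimensional Lebesgue measure, as an iterated product; its value on boxes is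
   [lebesgue_rV_box]. *)
Fixpoint lebesgue_rV (R : realType) (n : nat) :
    {sigma_finite_measure set 'rV[R]_n -> \bar R} :=
  if n is n'.+1 then lebesgue_step (lebesgue_rV R n')
  else \d_(0 : 'rV[R]_0).

Lemma lebesgue_rV_box (R : realType) n (A : 'I_n -> set (measurableTypeR R)) :
  (forall i, measurable (A i)) ->
  lebesgue_rV R n [set x | forall i, A i (x ord0 i)] =
  (\prod_(i < n) lebesgue_measure (A i))%E.
Proof.
elim: n A => [|n IHn] A mA.
  by rewrite big_ord0 /= diracE mem_set// => -[].
have mB : measurable
    [set x : 'rV[R]_n | forall i, A (lift ord0 i) (x ord0 i)].
  rewrite (_ : mkset _ = \bigcap_(i in [set: 'I_n])
      ((fun x : 'rV[R]_n => x ord0 i : measurableTypeR R) @^-1`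
       A (lift ord0 i))); last first.
    by apply/seteqP; split=> x Ax i; [move=> _|]; exact: Ax.
  apply: fin_bigcap_measurable => // i _.
  by rewrite -[X in measurable X]setTI; exact: measurable_coord_rV.
rewrite big_ord_recl -(IHn (fun i => A (lift ord0 i)))//.
rewrite -product_measure1E// /= /lebesgue_step /pushforward.
congr (product_measure1 _ _ _).
have l0 : @lshift 1 n ord0 = ord0 :> 'I_(1 + n) by exact/val_inj.
have rl j : @rshift 1 n j = lift ord0 j :> 'I_(1 + n) by exact/val_inj.
apply/seteqP; split=> -[a v] /=.
  move=> Aav; split=> [|i].
    by rewrite -[a]/((a, v).1) -(cons_rVl _ ord0) l0; exact: Aav.
  by rewrite -[v]/((a, v).2) -cons_rVr rl; exact: Aav.
move=> [Aa Av]; rewrite -[n.+1]/(1 + n)%N => i; rewrite -(splitK i).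
case: (fintype.split i) => j /=; first by rewrite cons_rVl (ord1 j) l0.
by rewrite cons_rVr rl; exact: Av.
Qed.

Section geometry.
Context {R : realType} {N : nat}.
Implicit Types (x y z w : 'rV[R]_N) (a b : \bar R).

Definition inner y z : R := \sum_(i < N) y ord0 i * z ord0 i.

Definition enorm z : R := Num.sqrt (inner z z).

Definition cball x (r : R) : set 'rV[R]_N := [set z | enorm (z - x) <= r].

Definition usphere : set 'rV[R]_N := [set y | enorm y = 1].

(* 0-based: [ebase 0] and [ebase 1] are the vectors e_1 and e_2. *)
Definition ebase (k : nat) : 'rV[R]_N := \row_(j < N) (j == k :> nat)%:R.

Definition angle y z : R := acos (inner y z / (enorm y * enorm z)).

Definition cone (alpha : R) a b y : set 'rV[R]_N :=
  [set z | [/\ (a < (enorm z)%:E)%E, ((enorm z)%:E < b)%E & angle y z < alpha]].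

Definition direction z : 'rV[R]_N := (enorm z)^-1 *: z.

Definition punctured_ball : set 'rV[R]_N := [set z | 0 < enorm z < 1].

Lemma measurable_enorm : measurable_fun setT enorm.
Proof.
have mi : measurable_fun setT (fun z : 'rV[R]_N => inner z z).
  apply: measurable_sum => i; apply: measurable_funM;
    exact: measurable_coord_rV.
have ms : measurable_fun setT (@Num.sqrt R).
  by apply: continuous_measurable_fun; exact: sqrt_continuous.
exact: (measurableT_comp ms mi).
Qed.

Lemma measurable_direction : measurable_fun setT direction.
Proof.
apply/measurable_fun_rVP => i.
rewrite (_ : (fun z : 'rV[R]_N => _) =
    (fun z => enorm z `^ (-1) * z ord0 i)); last first.
  by apply/funext => z; rewrite mxE powR_inv1// sqrtr_ge0.
apply: measurable_funM; last exact: measurable_coord_rV.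
exact: (measurableT_comp (measurable_powR (-1)) measurable_enorm).
Qed.

Lemma measurable_punctured_ball : measurable punctured_ball.
Proof.
rewrite (_ : punctured_ball = enorm @^-1` `]0, 1[%classic); last first.
  by apply/seteqP; split=> z /=; rewrite in_itv.
by rewrite -[X in measurable X]setTI; exact: measurable_enorm.
Qed.

(* Surface measure on the unit sphere, as a measure on R^N carried by the
   sphere: sigma(A) = N * |{z : 0 < |z| < 1, z / |z| in A}|. *)
Definition sphere_measure (A : set 'rV[R]_N) : \bar R :=
  (N%:R%:E * lebesgue_rV R N (direction @^-1` A `&` punctured_ball))%E.

Let sphere_measure0 : sphere_measure set0 = 0%E.
Proof. by rewrite /sphere_measure preimage_set0 set0I measure0 mule0. Qed.

Let sphere_measure_ge0 A : (0 <= sphere_measure A)%E.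
Proof. by rewrite /sphere_measure mule_ge0. Qed.

Let sphere_measure_sigma_additive : semi_sigma_additive sphere_measure.
Proof.
exact: (@measure_semi_sigma_additive _ _ _ (mscale N%:R%:nng
  (measure_function_pushforward__canonical__measure_function_Measure
     (mrestr (lebesgue_rV R N) measurable_punctured_ball)
     measurable_direction))).
Qed.

HB.instance Definition _ := isMeasure.Build _ _ _ sphere_measure
  sphere_measure0 sphere_measure_ge0 sphere_measure_sigma_additive.

Definition is_cone_angle (p alpha : R) : Prop :=
  let A := [set z | enorm z = 1 /\ angle (ebase 0) z < alpha] in
  0 < alpha <= pi / 2 /\
  p - 1 = (\int[sphere_measure]_(z in A) (inner z (ebase 0) ^+ 2)) /
          (\int[sphere_measure]_(z in A) (inner z (ebase 1) ^+ 2)).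

(* Matrices act on row vectors from the right: z is mapped to z *m M. *)
Definition is_SO (M : 'M[R]_N) : Prop := M *m M^T = 1%:M /\ \det M = 1.

(* [rot y' y] is R_{y',y}, mapping y to y'.  For y' <> y, -y, a rotation in the
   plane spanned by y and y' is an element of SO(N) fixing the orthogonal
   complement of that plane; with y |-> y' it is unique.  For y' = -y the choice
   is arbitrary. *)
Definition is_rotation_family (rot : 'rV[R]_N -> 'rV[R]_N -> 'M[R]_N) : Prop :=
  forall y' y, usphere y' -> usphere y ->
    [/\ is_SO (rot y' y), y *m rot y' y = y',
        y' = y -> rot y' y = 1%:M &
        y' <> y -> y' <> - y ->
          forall w, inner w y = 0 -> inner w y' = 0 -> w *m rot y' y = w].

End geometry.

Arguments is_cone_angle {R} N p alpha.

Section operator.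
Context {R : realType} {N : nat}.
Variables (s alpha : R) (rot : 'rV[R]_N -> 'rV[R]_N -> 'M[R]_N).
Implicit Types (u phi F : 'rV[R]_N -> R) (D : set 'rV[R]_N).

Definition Gamma (t : R) : R :=
  \int[lebesgue_measure]_(x in `]0, +oo[) (x `^ (t - 1) * expR (- x)).

Definition const_C : R :=
  4 `^ s * s * Gamma (N%:R / 2 + s) / (pi `^ (N%:R / 2) * Gamma (1 - s)).

Definition mu_density (z : 'rV[R]_N) : R :=
  const_C / enorm z `^ (N%:R + 2 * s).

Definition cone_integral u x y y' (eps : R) : \bar R :=
  (\int[lebesgue_rV R N]_(z in cone alpha eps%:E +oo y)
     ((u (x + z) + u (x - z *m rot y' y) - 2 * u x) * mu_density z)%:E)%E.

(* For bounded Borel u that is C^{1,1} at x the limit below exists in \bar R for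
   all y, y'; only at such u is the value of [Lop u x] meaningful.  This is the
   case of all the functions to which [viscosity_subsolution] applies it. *)
Definition Lop u x : \bar R :=
  ereal_sup [set ereal_inf
    [set lim (cone_integral u x y y' eps @[eps --> 0^'+]) | y' in usphere]
  | y in usphere].

Definition C1 phi : Prop :=
  forall i : 'I_N, (forall x, derivable phi x (ebase i)) /\
    continuous (fun x => 'D_(ebase i) phi x).

Definition C2 phi : Prop :=
  C1 phi /\ forall i : 'I_N, C1 (fun x => 'D_(ebase i) phi x).

Definition viscosity_subsolution D u : Prop :=
  [/\ bounded_fun u, unif_continuous u &
    forall x r phi, D x -> 0 < r -> C2 phi -> phi x = u x ->
      (forall z, cball x r z -> z <> x -> u z < phi z) ->
      (0 <= Lop (fun z => \1_(cball x r) z * phi z +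
                          \1_(~` cball x r) z * u z)%R x)%E].

Definition viscosity_supersolution D u : Prop :=
  viscosity_subsolution D (- u).

Definition viscosity_solution D F u : Prop :=
  [/\ viscosity_subsolution D u, viscosity_supersolution D u &
      forall x, ~ D x -> u x = F x].

End operator.

(* Main.v *)
Require Import Defs.
From mathcomp Require Import all_boot all_order all_algebra.
From mathcomp Require Import all_classical all_reals all_analysis.
From mathcomp Require Import measurable_realfun.
From mathcomp Require Import ring lra.

Set Implicit Arguments.
Unset Strict Implicit.
Unset Printing Implicit Defensive.

Import Order.TTheory GRing.Theory Num.Theory.
Import numFieldNormedType.Exports.
Local Open Scope classical_set_scope.
Local Open Scope ring_scope.

(** Uniqueness follows from comparison: if [u] and [w] are subsolutions with
    u + w = 0 off D, then u + w <= 0; it is applied to (u, -v) and (v, -u).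

    Suppose u + w takes a value M > 0 in D, and maximize
    u(x) + w(y) - |x - y|^2/2e.  For e small, uniform continuity keeps this function
    below M/4 off D x D, so its maximum is at some (x0, y0) in D x D, where [u] and
    [w] are touched from above by paraboloids with opposite gradients p and -p,
    p = (x0 - y0)/e ([doubled_max], [subsolution_paraboloid]).

    Let gu and gw be the increments of the two test functions from x0 and y0, and
    J(g, y) the integral of g against the kernel over the truncated cone T(y).  Since
    Lebesgue measure is invariant under orthogonal maps, the integral of the operator
    for directions (y, y') is J(g, y) + J(g, -y') ([cone_integralE]).  The subsolution
    property of [u] then gives a direction y1 such that, whatever y is,
    J(gu, y1) + J(gu, y) > -delta for small truncations; likewise [w] gives a
    direction y2 ([Lop_ge0_near]).  Taking y = y2 in the first inequality and y = y1
    in the second, and adding, leaves J(gu + gw, y1) + J(gu + gw, y2) > -2 delta.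
    Pairing the directions in this way treats zero and nonzero gradients alike.

    In gu + gw the first-order terms cancel.  Within distance r of the apex what is
    left is a multiple of |z|^2, which contributes at most a constant times
    r^(2 - 2s) ([cone_int_sqr_eball_le]); beyond r the sum is nonpositive because
    (x0, y0) is a maximum; and where both x0 + z and y0 + z have left D it is at most
    -M/2, which contributes at most -c M/2 with c independent of the direction
    and of r ([cone_int_tail_ge]).  For r small this is a contradiction.

    Two further points need proof.  The operator is defined with a limit in the
    extended reals, which says something only where it exists: for a paraboloid the
    first-order part of a cone integral is a multiple of a monotone function of the
    truncation, by symmetry of the cone about its axis ([cone_int_axis],
    [cvg_cone_int_paraboloid]).  And the kernel must not vanish: its normalizing
    constant is positive because the Gamma integrals are finite and positive
    ([const_C_gt0]). *)

(** * Euclidean geometry of row vectors *)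

Section euclid.
Context {R : realType} {N : nat}.
Implicit Types (x y z w : 'rV[R]_N) (M : 'M[R]_N) (a b t : R).

Lemma innerC y z : inner y z = inner z y.
Proof. by apply: eq_bigr => i _; rewrite mulrC. Qed.

Lemma innerDl y z w : inner (y + z) w = inner y w + inner z w.
Proof. by rewrite /inner -big_split; apply: eq_bigr => i _; rewrite mxE mulrDl. Qed.

Lemma innerZl a y z : inner (a *: y) z = a * inner y z.
Proof. by rewrite /inner mulr_sumr; apply: eq_bigr => i _; rewrite mxE mulrA. Qed.

Lemma innerNl y z : inner (- y) z = - inner y z.
Proof. by rewrite -scaleN1r innerZl mulN1r. Qed.

Lemma innerDr y z w : inner w (y + z) = inner w y + inner w z.
Proof. by rewrite innerC innerDl !(innerC w). Qed.

Lemma innerZr a y z : inner y (a *: z) = a * inner y z.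
Proof. by rewrite innerC innerZl innerC. Qed.

Lemma innerNr y z : inner y (- z) = - inner y z.
Proof. by rewrite innerC innerNl innerC. Qed.

Definition innerE := (innerDl, innerDr, innerZl, innerZr, innerNl, innerNr).

Lemma inner_mulmx y z : inner y z = (y *m z^T) ord0 ord0.
Proof. by rewrite mxE; apply: eq_bigr => i _; rewrite mxE. Qed.

Lemma inner_ge0 z : 0 <= inner z z.
Proof. by apply: sumr_ge0 => i _; rewrite -expr2 sqr_ge0. Qed.

Lemma enorm_ge0 z : 0 <= enorm z.
Proof. exact: sqrtr_ge0. Qed.

Lemma enorm_sqr z : enorm z ^+ 2 = inner z z.
Proof. by rewrite sqr_sqrtr// inner_ge0. Qed.

Lemma enorm0_eq0 z : enorm z = 0 -> z = 0.
Proof.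
move=> z0; have /eqP := enorm_sqr z; rewrite z0 expr0n /= eq_sym.
rewrite psumr_eq0; last by move=> i _; rewrite -expr2 sqr_ge0.
move=> /allP h; apply/rowP => i; rewrite mxE.
by have := h i (mem_index_enum _); rewrite /= mulf_eq0 orbb => /eqP.
Qed.

Lemma enorm_gt0 z : z <> 0 -> 0 < enorm z.
Proof.
by move=> z0; rewrite lt_neqAle enorm_ge0 andbT eq_sym; apply/eqP => /enorm0_eq0.
Qed.

Lemma enormN z : enorm (- z) = enorm z.
Proof. by rewrite /enorm innerNl innerNr opprK. Qed.

Lemma enormZ a z : enorm (a *: z) = `|a| * enorm z.
Proof.
rewrite /enorm innerZl innerZr mulrA -expr2 sqrtrM ?sqr_ge0//.
by rewrite sqrtr_sqr.
Qed.

Lemma enorm0 : enorm (0 : 'rV[R]_N) = 0.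
Proof. by rewrite -(scale0r 0) enormZ normr0 mul0r. Qed.

Lemma normr_inner_le y z : `|inner y z| <= enorm y * enorm z.
Proof.
have [z0|/eqP z0] := eqVneq z 0.
  have -> : inner y z = 0 by rewrite z0 -(scale0r y) innerZr mul0r.
  by rewrite normr0 mulr_ge0 ?enorm_ge0.
have zz : 0 < inner z z by rewrite -enorm_sqr exprn_gt0// enorm_gt0.
rewrite -ler_sqr ?nnegrE ?mulr_ge0 ?enorm_ge0// exprMn !enorm_sqr real_normK ?num_real//.
have := inner_ge0 (inner z z *: y - inner y z *: z).
rewrite !innerE (innerC z y).
rewrite (_ : _ + _ = inner z z * (inner y y * inner z z - inner y z ^+ 2)); last ring.
by rewrite pmulr_rge0// subr_ge0.
Qed.

Lemma inner_le y z : inner y z <= enorm y * enorm z.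
Proof. exact: le_trans (ler_norm _) (normr_inner_le y z). Qed.

Lemma enormD y z : enorm (y + z) <= enorm y + enorm z.
Proof.
rewrite -ler_sqr ?nnegrE ?addr_ge0 ?enorm_ge0//.
rewrite enorm_sqr !innerE (innerC z y) sqrrD !enorm_sqr.
by have := inner_le y z; lra.
Qed.

Lemma enormB_ge y z : enorm y - enorm z <= enorm (y + z).
Proof. by rewrite lerBlDr -{1}(addrK z y) -(enormN z) enormD. Qed.

Lemma normr_coord_le z i : `|z ord0 i| <= enorm z.
Proof.
rewrite -ler_sqr ?nnegrE ?enorm_ge0// enorm_sqr real_normK ?num_real// expr2.
rewrite /inner (bigD1 i)//= lerDl sumr_ge0// => j _.
by rewrite -expr2 sqr_ge0.
Qed.

Lemma normr_le_enorm z : `|z| <= enorm z.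
Proof.
rewrite [leLHS]/Num.norm/= mx_normrE; apply/bigmax_leP; split.
  exact: enorm_ge0.
by move=> -[i j] _ /=; rewrite (ord1 i) normr_coord_le.
Qed.

Lemma enorm_le_coord z b : (forall i, `|z ord0 i| <= b) ->
  enorm z <= N%:R * b.
Proof.
move=> zb; have [b0|b0] := ltP b 0.
  suff -> : z = 0.
    rewrite enorm0; have [->|] := posnP N; first by rewrite mul0r.
    by move=> N0; have := le_lt_trans (zb (Ordinal N0)) b0; rewrite normr_lt0.
  by apply/rowP => i; have := le_lt_trans (zb i) b0; rewrite normr_lt0.
rewrite -ler_sqr ?nnegrE ?mulr_ge0 ?enorm_ge0// enorm_sqr exprMn.
apply: (@le_trans _ _ (N%:R * b ^+ 2)).
  rewrite -mulr_natl mulr1 mulr_natl -[X in _ *+ X]card_ord -sumr_const.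
  apply: ler_sum => i _; rewrite -expr2 -real_normK ?num_real//.
  by rewrite ler_sqr ?nnegrE.
rewrite ler_wpM2r ?sqr_ge0// -natrX ler_nat.
by case: N => // n; rewrite expnS expn1 leq_pmulr.
Qed.

(** Both determinants are allowed: beside rotations, the maps -R and the half-turns
    about the axis of a cone, which reverse orientation in some dimensions, are used. *)
Definition orthogonal M := M *m M^T = 1%:M.

Lemma inner_orth M y z : orthogonal M -> inner (y *m M) (z *m M) = inner y z.
Proof.
by move=> oM; rewrite !inner_mulmx trmx_mul mulmxA -(mulmxA y) oM mulmx1.
Qed.

Lemma enorm_orth M z : orthogonal M -> enorm (z *m M) = enorm z.
Proof. by move=> oM; rewrite /enorm inner_orth. Qed.

Lemma orthogonalN M : orthogonal M -> orthogonal (- M).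
Proof. by rewrite /orthogonal linearN /= mulNmx mulmxN opprK. Qed.

(** The half-turn about the axis [y], that is z |-> 2<z,y>y - z. *)
Definition axis_flip y : 'M[R]_N := 2 *: (y^T *m y) - 1%:M.

Lemma axis_flipE y z : z *m axis_flip y = (2 * inner z y) *: y - z.
Proof.
rewrite /axis_flip mulmxBr mulmx1 -scalemxAr mulmxA -scalerA.
congr (_ *: _ - _); rewrite inner_mulmx; apply/rowP => j.
by rewrite !mxE big_ord1 !mxE.
Qed.

Lemma orthogonal_axis_flip y : inner y y = 1 -> orthogonal (axis_flip y).
Proof.
move=> y1; rewrite /orthogonal.
rewrite [X in _ *m X](_ : _ = axis_flip y); last first.
  by rewrite /axis_flip linearB /= linearZ /= trmx_mul trmxK trmx1.
apply/row_matrixP => i; rewrite row_mul axis_flipE (rowE i (axis_flip y)) axis_flipE.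
rewrite !innerE y1 row1; set e := delta_mx _ _.
by rewrite opprB addrCA -scalerBl (_ : _ - _ = 0) ?scale0r ?addr0//; ring.
Qed.

End euclid.

(** * Lebesgue measure on row vectors *)

Section lebesgue.
Context {R : realType} {n : nat}.
Implicit Types (x y z a : 'rV[R]_n) (A B : set 'rV[R]_n) (b r : R).

Local Notation m := (lebesgue_rV R n).

Lemma measurable_box (A : 'I_n -> set (measurableTypeR R)) :
  (forall i, measurable (A i)) ->
  measurable [set x : 'rV[R]_n | forall i, A i (x ord0 i)].
Proof.
move=> mA; rewrite (_ : mkset _ = \bigcap_(i in [set: 'I_n])
    ((fun x : 'rV[R]_n => x ord0 i : measurableTypeR R) @^-1` A i)); last first.
  by apply/seteqP; split=> x Ax i; [move=> _|]; exact: Ax.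
apply: fin_bigcap_measurable => // i _.
by rewrite -[X in measurable X]setTI; exact: measurable_coord_rV.
Qed.

(** A point of an open set lies in a cube with rational centre and small side
    contained in that set, and there are only countably many such cubes. *)
Lemma open_measurable_rV A : open A -> measurable A.
Proof.
move=> oA.
pose Q (p : 'rV[rat]_n * nat) : set 'rV[R]_n :=
  [set x | forall i, `](ratr (p.1 ord0 i) - p.2.+1%:R^-1),
                       (ratr (p.1 ord0 i) + p.2.+1%:R^-1)[%classic (x ord0 i)].
pose F p := if `[< Q p `<=` A >] then Q p else set0.
have -> : A = \bigcup_p F p.
  apply/seteqP; split=> [x Ax|x [p _]]; last first.
    by rewrite /F; case: asboolP => // QA /QA.
  have /nbhs_ballP[e /= e0 xeA] : nbhs x A by exact: open_nbhs_nbhs.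
  have [k [h [hE h0 he]]] : exists k (h : R),
      [/\ k.+1%:R^-1 = h, 0 < h & h < e / 2].
    exists (Num.truncn (2 / e)); eexists; split; first by [].
      by rewrite invr_gt0.
    by rewrite -(invf_div 2 e) ltf_pV2 ?posrE ?divr_gt0// truncnS_gt.
  have /choice[q qx] i : exists q : rat, ratr q \in
      `](x ord0 i - h), (x ord0 i + h)[.
    by apply: rat_in_itvoo; lra.
  exists (\row_i q i, k) => //; rewrite /F asboolT /Q/= hE.
    by move=> i; have := qx i; rewrite mxE !in_itv/=; lra.
  move=> z /= zQ; apply: xeA; rewrite -ball_normE /=.
  rewrite [X in X < _]/Num.norm/= mx_normrE; apply/bigmax_ltP; split=> //.
  move=> [i j] _ /=; rewrite (ord1 i) !mxE ltr_norml.
  have := qx j; have := zQ j; rewrite !in_itv/= mxE; lra.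
apply: countable_bigcupT_measurable => [|p]; first exact: countableP.
rewrite /F; case: ifPn => // _.
apply: (@measurable_box (fun i => `](ratr (p.1 ord0 i) - p.2.+1%:R^-1),
                                    (ratr (p.1 ord0 i) + p.2.+1%:R^-1)[%classic)).
by move=> i; exact: measurable_itv.
Qed.

Lemma continuous_measurable_rV (f : 'rV[R]_n -> R) :
  continuous f -> measurable_fun setT f.
Proof.
move=> cf; apply: (measurability _ (RGenOpens.measurableE R)).
move=> _ [_ [a [b ->] <-]]; rewrite setTI; apply: open_measurable_rV.
by move/continuousP : cf; apply; exact: interval_open.
Qed.

Definition cube a b : set 'rV[R]_n := [set x | forall i, `|x ord0 i - a ord0 i| <= b].

Lemma cube_itv a b : cube a b =
  [set x | forall i, `[(a ord0 i - b), (a ord0 i + b)]%classic (x ord0 i)].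
Proof.
by apply/seteqP; split=> x h i; have := h i;
  rewrite /= in_itv/= ler_distl.
Qed.

Lemma measurable_cube a b : measurable (cube a b).
Proof.
rewrite cube_itv; apply: (@measurable_box
  (fun i => `[(a ord0 i - b), (a ord0 i + b)]%classic)) => i.
exact: measurable_itv.
Qed.

Lemma lebesgue_cube a b : 0 <= b -> m (cube a b) = ((2 * b) ^+ n)%:E.
Proof.
move=> b0; rewrite cube_itv (@lebesgue_rV_box _ _
  (fun i => `[(a ord0 i - b), (a ord0 i + b)]%classic)); last first.
  by move=> i; exact: measurable_itv.
rewrite -[in RHS](card_ord n) -prodr_const -prodEFin; apply: eq_bigr => i _.
rewrite lebesgue_measure_itv/= lte_fin; case: ltP => h.
  by rewrite -EFinB; congr EFin; ring.
by congr EFin; lra.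
Qed.

Lemma measurable_addr_rV a : measurable_fun setT (fun x => x + a).
Proof.
apply/measurable_fun_rVP => i.
rewrite (_ : (fun _ => _) = (fun x : 'rV[R]_n => x ord0 i + a ord0 i)).
  by apply: measurable_funD => //; exact: measurable_coord_rV.
by apply/funext => x; rewrite mxE.
Qed.

Lemma measurable_mulmx_rV (M : 'M[R]_n) : measurable_fun setT (fun x => x *m M).
Proof.
apply/measurable_fun_rVP => i.
rewrite (_ : (fun _ => _) = (fun x : 'rV[R]_n => \sum_j x ord0 j * M j i)).
  apply: measurable_sum => j; apply: measurable_funM => //.
  exact: measurable_coord_rV.
by apply/funext => x; rewrite mxE.
Qed.

Lemma lebesgue_measureD (c : R) (A : set (measurableTypeR R)) : measurable A ->
  lebesgue_measure ((fun t => t + c) @^-1` A) = lebesgue_measure A.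
Proof.
pose phi (t : measurableTypeR R) : measurableTypeR R := t + c.
have mphi : measurable_fun setT phi by exact: measurable_funD.
move=> mA; rewrite -[LHS]/(pushforward lebesgue_measure phi A).
apply/esym; pose mu := measure_function_pushforward__canonical__measure_function_Measure
  (@lebesgue_measure R) mphi.
apply: (@lebesgue_measure_unique _ mu) => // X /ocitvP[->|].
  by rewrite !measure0.
move=> [[u v] /= uv ->]; rewrite /= /pushforward.
rewrite (_ : _ @^-1` _ = `](u - c), (v - c)]%classic); last first.
  by apply/seteqP; split=> t /=; rewrite /phi !in_itv/=; lra.
by rewrite !lebesgue_measure_itv/= !lte_fin ltrD2r uv -!EFinB; congr EFin; ring.
Qed.

(** Boxes with measurable sides are stable by intersection and generate, so the
    product formula determines the measure. *)
Lemma lebesgue_rVD a A : measurable A -> m ((fun x => x + a) @^-1` A) = m A.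
Proof.
move=> mA; rewrite -[LHS]/(pushforward m (fun x => x + a) A).
pose mu := measure_function_pushforward__canonical__measure_function_Measure
  m (measurable_addr_rV a).
pose G := [set B : set 'rV[R]_n | exists2 C : 'I_n -> set (measurableTypeR R),
  (forall i, measurable (C i)) & B = [set x : 'rV[R]_n | forall i, C i (x ord0 i)]].
apply/esym; transitivity (mu A); last by [].
apply: (measure_unique G (fun k => cube 0 k%:R)).
- apply/seteqP; split.
    apply: smallest_sub; first exact: smallest_sigma_algebra.
    rewrite -bigcup_seq => B [i _ [C mC <-]]; rewrite setTI.
    apply: sub_sigma_algebra; exists (fun j => if j == i then C else setT).
      by move=> j; case: ifP.
    apply/seteqP; split=> x /= h; last by have := h i; rewrite eqxx.
    by move=> j; case: eqP => // ->.
  apply: smallest_sub; first exact: smallest_sigma_algebra.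
  by move=> B [C mC ->]; exact: measurable_box.
- move=> _ _ [C mC ->] [C' mC' ->]; exists (fun i => C i `&` C' i).
    by move=> i; exact: measurableI.
  by apply/seteqP; split=> x /= => [[h h'] i|h]; split => // i; have [] := h i.
- move=> k; rewrite cube_itv.
  by exists (fun i => `[((0 : 'rV[R]_n) ord0 i - k%:R), ((0 : 'rV[R]_n) ord0 i + k%:R)]%classic).
- apply/seteqP; split=> // x _; exists (Num.truncn (enorm x)).+1 => //= i.
  rewrite mxE subr0 (le_trans (normr_coord_le _ _))//.
  by rewrite ltW// truncnS_gt.
- move=> _ [C mC ->]; rewrite /= /pushforward.
  rewrite (lebesgue_rV_box mC).
  rewrite (_ : _ @^-1` _ =
    [set x : 'rV[R]_n | forall i, ((fun t => t + a ord0 i) @^-1` C i) (x ord0 i)]); last first.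
    by apply/seteqP; split=> x /= h i; have := h i; rewrite mxE.
  rewrite (@lebesgue_rV_box _ _ (fun i => (fun t => t + a ord0 i) @^-1` C i)); last first.
    move=> i; rewrite -[X in measurable X]setTI.
    have ma : measurable_fun setT
        (fun t : measurableTypeR R => t + a ord0 i : measurableTypeR R).
      exact: measurable_funD.
    exact: (ma measurableT _ (mC i)).
  by apply: eq_bigr => i _; rewrite lebesgue_measureD.
- by move=> k; rewrite /= lebesgue_cube// ltry.
- by [].
Qed.

End lebesgue.

Section lebesgue_orthogonal.
Context {R : realType} {n : nat}.
Implicit Types (x y z a : 'rV[R]_n) (A B : set 'rV[R]_n) (b r : R).

Local Notation m := (lebesgue_rV R n).

Lemma measurable_preimage_rV d (T : measurableType d) (f : T -> 'rV[R]_n) A :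
  measurable_fun setT f -> measurable A -> measurable (f @^-1` A).
Proof. by move=> mf mA; rewrite -[X in measurable X]setTI; exact: mf. Qed.

Definition eball r : set 'rV[R]_n := [set z | enorm z <= r].

Lemma measurable_eball r : measurable (eball r).
Proof.
rewrite (_ : eball r = enorm @^-1` `]-oo, r]%classic); last first.
  by apply/seteqP; split=> z /=; rewrite in_itv.
by rewrite -[X in measurable X]setTI; exact: measurable_enorm.
Qed.

Lemma lebesgue_eball_le r : 0 <= r -> (m (eball r) <= ((2 * r) ^+ n)%:E)%E.
Proof.
move=> r0; rewrite -(lebesgue_cube 0 r0); apply: le_measure.
- by rewrite inE; exact: measurable_eball.
- by rewrite inE; exact: measurable_cube.
- move=> z zr i; rewrite mxE subr0; exact: le_trans (normr_coord_le _ _) zr.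
Qed.

Lemma lebesgue_eball_gt0 r : 0 < r -> (0 < m (eball r))%E.
Proof.
move=> r0; have b0 : 0 < r / n.+1%:R by rewrite divr_gt0.
apply: (@lt_le_trans _ _ (m (cube 0 (r / n.+1%:R)))).
  by rewrite lebesgue_cube ?ltW// lte_fin exprn_gt0// mulr_gt0.
apply: le_measure.
- by rewrite inE; exact: measurable_cube.
- by rewrite inE; exact: measurable_eball.
- move=> z zr; rewrite /eball/=.
  apply: (le_trans (@enorm_le_coord _ _ _ (r / n.+1%:R) _)).
    by move=> i; have := zr i; rewrite mxE subr0.
  rewrite mulrA ler_pdivrMr// mulrC ler_wpM2l ?(ltW r0)//.
  by rewrite ler_nat.
Qed.

(** Two applications of Tonelli's theorem and translation invariance give
    |A| |phi^-1 B| = |phi^-1 A| |-B| for an additive bijection phi; both factors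
    carrying B agree when B is a Euclidean ball and phi is orthogonal. *)
Lemma lebesgue_rV_orth (M : 'M[R]_n) A : orthogonal M -> measurable A ->
  m ((fun x => x *m M) @^-1` A) = m A.
Proof.
move=> oM mA; set phi := fun x => x *m M.
have phiK x : (x *m M^T) *m M = x.
  by rewrite -mulmxA (mulmx1C oM) mulmx1.
have mphi : measurable_fun setT phi by exact: measurable_mulmx_rV.
pose B := eball 1; have mB : measurable B by exact: measurable_eball.
have phiB x : B (phi x) = B x by rewrite /B /eball/= enorm_orth.
have mphi2 : measurable_fun setT (fun q : 'rV[R]_n * 'rV[R]_n => phi q.2).
  exact: (measurableT_comp mphi measurable_snd).
have mD (f g : 'rV[R]_n * 'rV[R]_n -> 'rV[R]_n) :
    measurable_fun setT f -> measurable_fun setT g ->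
    measurable_fun setT (fun q => f q + g q).
  move=> mf mg; apply/measurable_fun_rVP => i.
  rewrite (_ : (fun _ => _) = (fun q => f q ord0 i + g q ord0 i)).
    by apply: measurable_funD; exact: (measurableT_comp (measurable_coord_rV i)).
  by apply/funext => x; rewrite mxE.
pose S := [set q : 'rV[R]_n * 'rV[R]_n | A (q.1 + phi q.2) /\ B q.2].
pose S' := [set q : 'rV[R]_n * 'rV[R]_n | A (phi q.2) /\ B (phi q.2 - q.1)].
have mS : measurable S.
  apply: measurableI.
    exact: (measurable_preimage_rV (mD _ _ measurable_fst mphi2) mA).
  exact: (measurable_preimage_rV measurable_snd mB).
have mS' : measurable S'.
  apply: measurableI; first exact: (measurable_preimage_rV mphi2 mA).
  have mo : measurable_fun setT (fun q : 'rV[R]_n * 'rV[R]_n => - q.1).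
    rewrite (_ : (fun _ => _) = (fun q => q.1 *m (- 1%:M))).
      exact: (measurableT_comp (measurable_mulmx_rV _) measurable_fst).
    by apply/funext => q; rewrite mulmxN mulmx1.
  exact: (measurable_preimage_rV (mD _ _ mphi2 mo) mB).
have tonelli (C : set ('rV[R]_n * 'rV[R]_n)) : measurable C ->
    (\int[m]_x m (xsection C x) = \int[m]_y m (ysection C y))%E.
  move=> mC; have := indic_fubini_tonelli m m mC.
  by rewrite indic_fubini_tonelli_FE// indic_fubini_tonelli_GE.
have const (k : \bar R) (C : set 'rV[R]_n) (f : 'rV[R]_n -> \bar R) : measurable C ->
    (forall y, f y = if y \in C then k else 0%E) ->
    (\int[m]_y f y = k * m C)%E.
  move=> mC fE; rewrite -integral_cst// [RHS]integral_mkcond.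
  by apply: eq_integral => y _; rewrite fE patchE.
have e1 : (\int[m]_y m (ysection S y) = m A * m B)%E.
  apply: const => // y; case: ifPn => [|] yB.
    rewrite -(lebesgue_rVD (phi y) mA); congr (m _).
    apply/seteqP; split=> x; rewrite /ysection/= inE /S/=; first by case.
    by move=> h; split=> //; rewrite inE in yB.
  rewrite (_ : ysection _ _ = set0) ?measure0//.
  apply/seteqP; split=> x //; rewrite /ysection/= inE /S/= => -[_ By].
  by rewrite notin_setE in yB.
have e2 : (\int[m]_y m (ysection S' y) = m B * m (phi @^-1` A))%E.
  apply: const => [|y]; first exact: measurable_preimage_rV.
  case: ifPn => [|] yA.
    rewrite -(lebesgue_rVD (- phi y) mB); congr (m _).
    apply/seteqP; split=> x; rewrite /ysection/= inE /S'/= /B /eball/= -enormN opprB.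
      by case.
    by move=> h; split=> //; rewrite inE in yA.
  rewrite (_ : ysection _ _ = set0) ?measure0//.
  apply/seteqP; split=> x //; rewrite /ysection/= inE /S'/= => -[Ay _].
  by rewrite notin_setE in yA.
have e3 : (\int[m]_x m (xsection S x) = \int[m]_x m (xsection S' x))%E.
  apply: eq_integral => x _.
  rewrite -(lebesgue_rVD (- (x *m M^T))); last exact: measurable_xsection.
  congr (m _); apply/seteqP.
  have SE y : xsection S x (y - x *m M^T) = xsection S' x y.
    rewrite /xsection/= !in_setE /S /S'/= -phiB /phi mulmxBl phiK.
    by rewrite addrC subrK.
  by split=> y /=; rewrite SE.
have B0 : (0 < m B)%E by exact: lebesgue_eball_gt0.
have Boo : (m B < +oo)%E.
  by rewrite (le_lt_trans (lebesgue_eball_le _))// ltry.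
have : (m A * m B = m (phi @^-1` A) * m B)%E.
  rewrite [RHS]muleC.
  exact: etrans (esym e1) (etrans (esym (tonelli S mS)) (etrans e3
    (etrans (tonelli S' mS') e2))).
have bE : m B = (fine (m B))%:E by rewrite fineK// ge0_fin_numE// ltW.
have b0 : fine (m B) != 0 by rewrite gt_eqF// -lte_fin -bE.
rewrite bE => /(congr1 (fun t => t * ((fine (m B))^-1)%:E)%E).
by rewrite -!muleA -EFinM divff// !mule1.
Qed.

End lebesgue_orthogonal.

(** * Integrals of power functions by dyadic layers *)

Section layers.
Context d (T : measurableType d) (R : realType) (mu : {measure set T -> \bar R}).

(** [f] is dominated on [A] by the sum of the [c k] times the indicators of the
    layers [B k], and the terms of that sum integrate to a geometric series. *)
Lemma integral_layers_le (f : T -> R) (A : set T) (B : nat -> set T)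
    (c : nat -> R) (q C : R) :
  measurable A -> measurable_fun A f -> (forall x, A x -> 0 <= f x) ->
  (forall k, measurable (B k)) -> (forall k, 0 <= c k) ->
  0 <= C -> 0 < q < 1 ->
  (forall k, ((c k)%:E * mu (B k) <= (C * q ^+ k)%:E)%E) ->
  (forall x, A x -> exists2 k, B k x & f x <= c k) ->
  (\int[mu]_(x in A) (f x)%:E <= (C / (1 - q))%:E)%E.
Proof.
move=> mA mf f0 mB c0 C0 /andP[q0 q1] cB fc.
have mI k : measurable_fun A (fun x => ((c k)%:E * (\1_(B k) x)%:E)%E).
  apply/measurable_EFinP; apply: measurable_funM => //.
have I0 k x : A x -> (0 <= (c k)%:E * (\1_(B k) x)%:E)%E.
  by move=> _; rewrite -EFinM lee_fin mulr_ge0.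
apply: (@le_trans _ _
    (\int[mu]_(x in A) \big[+%E/0%R]_(0 <= k <oo) ((c k)%:E * (\1_(B k) x)%:E))%E).
  apply: ge0_le_integral => //.
  - exact/measurable_EFinP.
  - by apply: ge0_emeasurable_sum => // k x Ax _; exact: I0.
  - move=> x Ax; have [k Bkx fck] := fc x Ax.
    apply: le_trans (nneseries_lim_ge k.+1 _); last by move=> n _ _; exact: I0.
    rewrite big_nat_recr//= indicE mem_set// mule1.
    rewrite -[leLHS]add0e leeD ?lee_fin// sume_ge0// => i _; exact: I0.
rewrite integral_nneseries//.
apply: lime_le.
  apply: is_cvg_nneseries => n _ _; apply: integral_ge0 => x Ax; exact: I0.
near=> n.
apply: (@le_trans _ _ (\sum_(0 <= k < n) (C * q ^+ k)%:E)%E).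
  apply: lee_sum => k _; apply: le_trans (cB k).
  rewrite ge0_integralZl_EFin//; last first.
    by apply/measurable_EFinP; exact: measurable_indic.
  rewrite integral_indic// lee_wpmul2l ?lee_fin//.
  apply: le_measure; rewrite ?inE//; exact: measurableI.
rewrite sumEFin lee_fin.
by apply: geometric_le_lim; rewrite // ger0_norm// ltW.
Unshelve. all: by end_near.
Qed.

End layers.

Section dyadic.
Context {R : realType}.
Implicit Types (x r e t : R).

Lemma powR_exprn x t k : 0 <= x -> (x ^+ k) `^ t = (x `^ t) ^+ k.
Proof.
move=> x0; elim: k => [|k IH]; first by rewrite !expr0 powR1.
by rewrite !exprS powRM ?exprn_ge0// IH.
Qed.

Lemma expr2_gt_real x : exists k, x < 2 ^+ k.
Proof.
exists (Num.truncn x).+1; apply: (lt_le_trans (truncnS_gt x)).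
by rewrite -natrX ler_nat ltnW// ltn_expl.
Qed.

Lemma dyadic_below x r : 0 < x <= r ->
  exists k, r * 2^-1 ^+ k.+1 < x <= r * 2^-1 ^+ k.
Proof.
move=> /andP[x0 xr].
have ex : exists k, r * 2^-1 ^+ k < x.
  have [k hk] := expr2_gt_real (r / x); exists k.
  by rewrite exprVn ltr_pdivrMr ?exprn_gt0// mulrC -ltr_pdivrMr.
have := ex_minnP ex; case; case=> [|k] hk kmin.
  by move: hk; rewrite expr0 mulr1 ltNge xr.
exists k; rewrite hk leNgt; apply/negP => /kmin.
by rewrite ltnn.
Qed.

Lemma dyadic_above x e : 0 < e < x ->
  exists k, e * 2 ^+ k < x <= e * 2 ^+ k.+1.
Proof.
move=> /andP[e0 ex].
have xk : exists k, x <= e * 2 ^+ k.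
  have [k hk] := expr2_gt_real (x / e); exists k.
  by rewrite mulrC -ler_pdivrMr// ltW.
have := ex_minnP xk; case; case=> [|k] hk kmin.
  by move: hk; rewrite expr0 mulr1 leNgt ex.
exists k; rewrite hk andbT ltNge; apply/negP => /kmin.
by rewrite ltnn.
Qed.

End dyadic.

(** * The Gamma function at positive arguments *)

Section gamma.
Context {R : realType}.
Implicit Types (t x : R).
Local Notation lambda := (@lebesgue_measure R).

Let f t x : R := x `^ (t - 1) * expR (- x).

Let f_ge0 t x : 0 <= f t x.
Proof. by rewrite mulr_ge0// ?powR_ge0 ?expR_ge0. Qed.

Let mf t : measurable_fun setT (f t).
Proof.
apply: measurable_funM; first exact: measurable_powR.
by apply: measurableT_comp => //; exact: measurable_expR.
Qed.

Let gamma_fin01 t : 0 < t ->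
  (\int[lambda]_(x in `]0%R, 1%R]) (f t x)%:E < +oo)%E.
Proof.
move=> t0.
apply: le_lt_trans (ltry (2 / (1 - 2^-1 `^ t))).
apply: (@integral_layers_le _ (measurableTypeR R) R lambda (f t) _
  (fun k => `](0 : R), 2^-1 ^+ k]%classic)
  (fun k => 2 * ((2^-1 `^ t) ^+ k) / (2^-1 ^+ k))) => //=.
- by have := @measurable_funTS _ _ _ _ _ _ (mf t); exact.
- have h : 2^-1 `^ t < (1 : R) `^ t.
    by apply: gt0_ltr_powR; rewrite ?nnegrE//; lra.
  by rewrite powR1 in h; rewrite powR_gt0//=.
- move=> k; rewrite lebesgue_measure_itv/= lte_fin exprn_gt0// sube0 -EFinM lee_fin.
  by rewrite mulfVK// expf_neq0.
- move=> x; rewrite /= in_itv/= => x01.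
  have [k /andP[kx xk]] := dyadic_below x01; rewrite !mul1r in kx xk.
  have x0 : 0 < x by case/andP : x01.
  exists k; first by rewrite /= in_itv/= x0.
  rewrite /f; apply: (@le_trans _ _ (x `^ (t - 1))).
    by rewrite ler_piMr ?powR_ge0// -expR0 ler_expR oppr_le0 ltW.
  rewrite powRB; last by rewrite (gt_eqF x0) implybT.
  rewrite powRr1 ?(ltW x0)// -powR_exprn// mulrAC mulrC.
  apply: ler_pM; rewrite ?powR_ge0 ?invr_ge0 ?(ltW x0)//.
    rewrite -[leRHS]invrK lef_pV2 ?posrE ?invr_gt0 ?divr_gt0 ?exprn_gt0//.
    by move: kx; rewrite exprSr => /ltW; rewrite invf_div.
  by apply: ge0_ler_powR; rewrite ?nnegrE ?(ltW x0) ?(ltW t0) ?exprn_ge0.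
Qed.

(** x = t (x/t) <= t exp(x/t), raised to the power t. *)
Let powR_le_expR t x : 0 < t -> 0 <= x -> x `^ t <= t `^ t * expR x.
Proof.
move=> t0 x0; rewrite -[x in expR x](divfK (lt0r_neq0 t0)) expRM.
rewrite -powRM ?expR_ge0 ?(ltW t0)//.
apply: ge0_ler_powR; rewrite ?nnegrE ?mulr_ge0 ?expR_ge0 ?(ltW t0)//.
rewrite mulrC -ler_pdivrMr//; apply: le_trans (expR_ge1Dx _).
by rewrite lerDr.
Qed.

Let gamma_fin1y t : 0 < t ->
  (\int[lambda]_(x in `]1%R, +oo[) (f t x)%:E < +oo)%E.
Proof.
move=> t0; pose K := (t + 1) `^ (t + 1).
have K0 : 0 <= K by exact: powR_ge0.
apply: le_lt_trans (ltry (2 * K / (1 - 2^-1))).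
apply: (@integral_layers_le _ (measurableTypeR R) R lambda (f t) _
  (fun k => `](0 : R), 2 ^+ k.+1]%classic)
  (fun k => K / (2 ^+ k) ^+ 2)) => //=.
- have := @measurable_funTS _ _ _ _ _ _ (mf t); exact.
- by move=> k; rewrite divr_ge0 ?exprn_ge0.
- by rewrite mulr_ge0.
- by rewrite invr_gt0 ltr0n/= invf_lt1// ltr1n.
- move=> k; rewrite lebesgue_measure_itv/= lte_fin exprn_gt0// sube0 -EFinM lee_fin.
  rewrite exprVn (exprS 2 k) le_eqVlt; apply/orP; left; apply/eqP; field.
  by rewrite expf_neq0.
- move=> x; rewrite /= in_itv/= andbT => x1.
  have [|k /andP[kx xk]] := @dyadic_above _ x 1; first by rewrite ltr01.
  rewrite !mul1r in kx xk; have x0 : 0 < x by exact: lt_trans x1.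
  exists k; first by rewrite /= in_itv/= x0.
  apply: (@le_trans _ _ (K / x ^+ 2)).
    rewrite /f ler_pdivlMr ?exprn_gt0// expRN mulrAC ler_pdivrMr ?expR_gt0//.
    rewrite -powR_mulrn ?(ltW x0)// -powRD ?(gt_eqF x0) ?implybT//.
    rewrite (_ : t - 1 + 2%:R = t + 1); last by ring.
    by apply: powR_le_expR; rewrite ?addr_gt0 ?(ltW x0).
  rewrite ler_wpM2l// lef_pV2 ?posrE ?exprn_gt0//.
  by rewrite ler_sqr ?nnegrE ?exprn_ge0 ?(ltW x0) ?(ltW kx).
Qed.

Lemma Gamma_gt0 t : 0 < t -> 0 < @Gamma R t.
Proof.
move=> t0; rewrite /Gamma /Rintegral.
have U : `](0 : R), +oo[%classic = `]0%R, 1%R] `|` `]1%R, +oo[%classic.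
  apply/seteqP; split=> x /=; rewrite !in_itv/= !andbT.
    by case: (leP x 1) => h x0; [left; rewrite x0|right].
  by case=> [/andP[]//|]; exact: lt_trans.
apply: fine_gt0; apply/andP; split; last first.
  rewrite U ge0_integral_setU//=.
  - by rewrite lte_add_pinfty ?gamma_fin01 ?gamma_fin1y.
  - by apply/measurable_EFinP; have := @measurable_funTS _ _ _ _ _ _ (mf t); exact.
  - by move=> x _; rewrite lee_fin f_ge0.
  - rewrite disj_set2E; apply/eqP/seteqP; split=> x //= [].
    by rewrite !in_itv/= => /andP[_ h]; rewrite andbT ltNge h.
pose c := (Num.min (1 `^ (t - 1)) (2 `^ (t - 1))) * expR (- 2) : R.
have c0 : 0 < c by rewrite mulr_gt0 ?expR_gt0// lt_min !powR_gt0.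
apply: (@lt_le_trans _ _ (\int[lambda]_(x in `[1%R, 2%R]) c%:E)%E).
  rewrite integral_cst//= lebesgue_measure_itv/= lte_fin ltr1n -EFinB -EFinM lte_fin.
  by rewrite mulr_gt0// subr_gt0 ltr1n.
apply: (@le_trans _ _ (\int[lambda]_(x in `[1%R, 2%R]) (f t x)%:E)%E).
  apply: ge0_le_integral => //=.
  - by move=> x _; rewrite lee_fin ltW.
  - by apply/measurable_EFinP; have := @measurable_funTS _ _ _ _ _ _ (mf t); exact.
  - move=> x; rewrite in_itv/= lee_fin => /andP[x1 x2].
    apply: ler_pM; rewrite ?expR_ge0 ?ler_expR ?lerN2// ?le_min ?powR_ge0//.
    rewrite ge_min; have [t1|t1] := leP 0 (t - 1).
      apply/orP; left.
      apply: ge0_ler_powR; rewrite ?nnegrE// (le_trans _ x1)//.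
    apply/orP; right; rewrite -[t - 1]opprK !(powRN _ (- (t - 1))) lef_pV2 ?posrE ?powR_gt0//.
      apply: ge0_ler_powR; rewrite ?nnegrE ?oppr_ge0 ?(ltW t1)// (le_trans _ x1)//.
    exact: lt_le_trans x1.
apply: ge0_subset_integral => //=.
- by apply/measurable_EFinP; have := @measurable_funTS _ _ _ _ _ _ (mf t); exact.
- by move=> x _; rewrite lee_fin f_ge0.
- move=> x /=; rewrite !in_itv/= andbT => /andP[x1 _]; exact: lt_le_trans x1.
Qed.

End gamma.

Lemma const_C_gt0 (R : realType) (N : nat) (s : R) :
  0 < s < 1 -> 0 < @const_C R N s.
Proof.
move=> /andP[s0 s1]; rewrite /const_C divr_gt0// !mulr_gt0 ?powR_gt0 ?pi_gt0//.
  by rewrite Gamma_gt0// ltr_wpDl// divr_ge0.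
by rewrite Gamma_gt0// subr_gt0.
Qed.

(** * Cones and the kernel *)

Section cones.
Context {R : realType} {N : nat}.
Implicit Types (x y z w : 'rV[R]_N) (M : 'M[R]_N) (alpha b r t eps : R).

Lemma usphere_inner y : usphere y -> inner y y = 1.
Proof. by rewrite -enorm_sqr => ->; rewrite expr1n. Qed.

Lemma usphereN y : usphere y -> usphere (- y).
Proof. by rewrite /usphere/= enormN. Qed.

Lemma usphere_orth M y : orthogonal M -> usphere y -> usphere (y *m M).
Proof. by move=> oM; rewrite /usphere/= enorm_orth. Qed.

Lemma cone_orth M alpha (a b : \bar R) y z : orthogonal M ->
  cone alpha a b (y *m M) (z *m M) <-> cone alpha a b y z.
Proof. by move=> oM; rewrite /cone/= /angle !enorm_orth// inner_orth. Qed.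

Lemma coneE alpha eps y : 0 < alpha <= pi / 2 -> 0 <= eps -> usphere y ->
  cone alpha eps%:E +oo y = [set z | eps < enorm z /\ cos alpha * enorm z < inner y z].
Proof.
move=> /andP[a0 api] e0 y1.
have pi0 : 0 < pi :> R by exact: pi_gt0.
have H z : 0 < enorm z -> (angle y z < alpha) = (cos alpha * enorm z < inner y z).
  move=> z0; rewrite /angle (_ : enorm y = 1)// mul1r; set t := _ / _.
  have t1 : -1 <= t <= 1.
    rewrite -ler_norml normrM normfV (ger0_norm (ltW z0)) ler_pdivrMr// mul1r.
    by have := normr_inner_le y z; rewrite (_ : enorm y = 1)// mul1r.
  have [/andP[h0 hpi] hc] := acos_def t1.
  by rewrite -ltr_pdivlMr// -/t -[in RHS]hc ltr_cos// in_itv/=; lra.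
apply/seteqP; split=> z /=; rewrite /cone/= lte_fin.
  by case=> ez _; rewrite H// (le_lt_trans e0).
by case=> ez; rewrite ltry H// (le_lt_trans e0).
Qed.

Lemma cos_cone_ge0 alpha : 0 < alpha <= pi / 2 -> 0 <= cos alpha < 1.
Proof.
move=> /andP[a0 api]; have pi0 : 0 < pi :> R by exact: pi_gt0.
have a1 : alpha \in `[0, pi] by rewrite in_itv/= (ltW a0)/=; lra.
apply/andP; split.
  by rewrite -(cos_pihalf R) leNgt ltr_cos ?in_itv/= -?leNgt ?api//; lra.
by rewrite -[ltRHS]cos0 ltr_cos// in_itv/= lexx/= ltW.
Qed.

Lemma measurable_inner y : measurable_fun setT (inner y).
Proof.
by apply: measurable_sum => i; apply: measurable_funM => //; exact: measurable_coord_rV.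
Qed.

Lemma measurable_cone alpha eps y : 0 < alpha <= pi / 2 -> 0 <= eps ->
  usphere y -> measurable (cone alpha eps%:E +oo y).
Proof.
move=> ha e0 y1; rewrite coneE//.
rewrite (_ : mkset _ = [set z | eps < enorm z] `&`
  [set z | cos alpha * enorm z < inner y z]); last first.
  by apply/seteqP; split=> z [].
apply: measurableI.
  rewrite (_ : mkset _ = enorm @^-1` `]eps, +oo[%classic); last first.
    by apply/seteqP; split=> z /=; rewrite in_itv/= andbT.
  by rewrite -[X in measurable X]setTI; exact: measurable_enorm.
rewrite (_ : mkset _ =
    (fun z => inner y z - cos alpha * enorm z) @^-1` `]0, +oo[%classic); last first.
  by apply/seteqP; split=> z /=; rewrite in_itv/= andbT subr_gt0.
rewrite -[X in measurable X]setTI; apply: measurable_funB => //.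
  exact: measurable_inner.
by apply: measurable_funM => //; exact: measurable_enorm.
Qed.

(** If |z - t y| <= eta t, then <y,z> >= (1 - eta) t while |z| <= (1 + eta) t; the
    choice eta = (1 - cos alpha)/4 keeps their ratio above cos alpha. *)
Lemma ball_sub_cone alpha eps t y z : 0 < alpha <= pi / 2 -> 0 <= eps ->
  usphere y -> 2 * eps < t ->
  enorm (z - t *: y) <= (1 - cos alpha) / 4 * t ->
  cone alpha eps%:E +oo y z /\ t / 2 < enorm z <= 2 * t.
Proof.
move=> ha e0 y1 et zt; have /andP[c0 c1] := cos_cone_ge0 ha.
have ey : enorm y = 1 by [].
have t0 : 0 < t by lra.
have ty : enorm (t *: y) = t by rewrite enormZ ey mulr1 ger0_norm// ltW.
have zE : z = t *: y + (z - t *: y) by rewrite addrC subrK.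
have z_le : enorm z <= t + (1 - cos alpha) / 4 * t.
  by rewrite {1}zE (le_trans (enormD _ _))// ty lerD2l.
have z_ge : t - (1 - cos alpha) / 4 * t <= enorm z.
  by rewrite [in leRHS]zE (le_trans _ (enormB_ge _ _))// ty lerD2l lerN2.
have yz : t - (1 - cos alpha) / 4 * t <= inner y z.
  rewrite zE innerDr innerZr (usphere_inner y1) mulr1 lerD2l.
  have := normr_inner_le y (z - t *: y); rewrite ey mul1r ler_norml => /andP[+ _].
  by apply: le_trans; rewrite lerN2.
have h : 0 <= (1 - cos alpha) / 4 * t <= t / 4.
  by rewrite mulr_ge0 ?divr_ge0 ?subr_ge0 ?(ltW c1) ?(ltW t0)//=; nra.
split; last by lra.
rewrite coneE//=; split; first lra.
apply: lt_le_trans yz; apply: (@le_lt_trans _ _ (cos alpha * (t + (1 - cos alpha) / 4 * t))).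
  by rewrite ler_wpM2l.
have : 0 < (1 - cos alpha) * t by rewrite mulr_gt0 ?subr_gt0.
nra.
Qed.

End cones.

Section kernel.
Context {R : realType} {N : nat}.
Variables (s alpha : R).
Hypothesis s01 : 0 < s < 1.
Hypothesis ha : 0 < alpha <= pi / 2.
Implicit Types (x y z w : 'rV[R]_N) (M : 'M[R]_N) (b r t eps : R).
Implicit Types (f g : 'rV[R]_N -> R).

Local Notation m := (lebesgue_rV R N).
Local Notation dens := (@mu_density R N s).
Local Notation C0 := (@const_C R N s).
Local Notation tcone eps y := (cone alpha eps%:E +oo y).

Let s0 : 0 < s. Proof. by case/andP: s01. Qed.
Let s1 : s < 1. Proof. by case/andP: s01. Qed.
Let nu : R := N%:R + 2 * s.
Let nu0 : 0 < nu. Proof. by rewrite ltr_wpDl// mulr_gt0. Qed.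
Let C0_gt0 : 0 < C0. Proof. exact: const_C_gt0. Qed.

Lemma dens_ge0 z : 0 <= dens z.
Proof. by rewrite divr_ge0 ?powR_ge0// ltW. Qed.

Lemma measurable_dens : measurable_fun setT dens.
Proof.
rewrite (_ : mu_density s = fun z => C0 * (enorm z `^ (- nu))).
  apply: measurable_funM => //.
  exact: (measurableT_comp (measurable_powR (- nu)) measurable_enorm).
by apply/funext => z; rewrite powRN.
Qed.

Lemma dens_le b z : 0 < b -> b <= enorm z -> dens z <= C0 / b `^ nu.
Proof.
move=> b0 bz; rewrite ler_wpM2l ?(ltW C0_gt0)//.
rewrite lef_pV2 ?posrE ?powR_gt0//; last exact: lt_le_trans bz.
by apply: ge0_ler_powR; rewrite ?nnegrE ?(ltW nu0) ?(ltW b0)// (le_trans (ltW b0)).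
Qed.

Lemma dens_ge b z : 0 < enorm z -> enorm z <= b -> C0 / b `^ nu <= dens z.
Proof.
move=> z0 zb; rewrite ler_wpM2l ?(ltW C0_gt0)//.
have b0 : 0 < b by exact: lt_le_trans zb.
rewrite lef_pV2 ?posrE ?powR_gt0//.
by apply: ge0_ler_powR; rewrite ?nnegrE ?(ltW nu0) ?(ltW b0) ?(ltW z0).
Qed.

Lemma dens_orth M z : orthogonal M -> dens (z *m M) = dens z.
Proof. by move=> oM; rewrite /mu_density enorm_orth. Qed.

Let half_powR t : 0 < t -> 0 < (2^-1 : R) `^ t < 1.
Proof.
move=> t0; have h : 2^-1 `^ t < (1 : R) `^ t.
  by apply: gt0_ltr_powR; rewrite ?nnegrE//; lra.
by rewrite powR1 in h; rewrite powR_gt0//=.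
Qed.

Let powR_nu b : 0 < b -> b `^ nu = b ^+ N * b `^ (2 * s).
Proof.
by move=> b0; rewrite /nu powRD ?(gt_eqF b0) ?implybT// powR_mulrn// ltW.
Qed.

(** On the layer where |z| is between e 2^k and e 2^(k+1), the density is at most
    C0/(e 2^k)^(N+2s), while the volume is at most (4 e 2^k)^N. *)
Lemma dens_tail_fin eps : 0 < eps ->
  (\int[m]_(z in [set z | (eps < enorm z)%R]) (dens z)%:E < +oo)%E.
Proof.
move=> e0.
have mA : measurable [set z : 'rV[R]_N | eps < enorm z].
  rewrite (_ : mkset _ = enorm @^-1` `]eps, +oo[%classic); last first.
    by apply/seteqP; split=> z /=; rewrite in_itv/= andbT.
  by rewrite -[X in measurable X]setTI; exact: measurable_enorm.
pose rho k := eps * 2 ^+ k.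
have rho0 k : 0 < rho k by rewrite mulr_gt0// exprn_gt0.
apply: le_lt_trans (ltry (C0 * 4 ^+ N / eps `^ (2 * s) / (1 - 2^-1 `^ (2 * s)))).
apply: (@integral_layers_le _ _ _ _ _ _ (fun k => eball (2 * rho k))
  (fun k => C0 / (rho k) `^ nu)) => //=.
- apply: measurable_funTS; exact: measurable_dens.
- by move=> z _; exact: dens_ge0.
- by move=> k; exact: measurable_eball.
- by move=> k; rewrite divr_ge0 ?powR_ge0// ltW.
- by rewrite divr_ge0 ?powR_ge0// mulr_ge0 ?exprn_ge0// ltW.
- by apply: half_powR; rewrite mulr_gt0.
- move=> k; apply: (@le_trans _ _
      ((C0 / rho k `^ nu)%:E * ((2 * (2 * rho k)) ^+ N)%:E)%E).
    rewrite lee_wpmul2l//.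
      by rewrite lee_fin divr_ge0 ?powR_ge0// ltW.
    by apply: lebesgue_eball_le; rewrite mulr_ge0// ltW.
  rewrite -EFinM lee_fin powR_nu// mulrA -natrM (_ : (2 * 2)%N = 4%N)// (exprMn _ _ (rho k)).
  have -> : rho k `^ (2 * s) = eps `^ (2 * s) * (2 `^ (2 * s)) ^+ k.
    by rewrite powRM ?exprn_ge0 ?(ltW e0)// powR_exprn.
  have h : (2^-1 : R) `^ (2 * s) = (2 `^ (2 * s))^-1.
    by rewrite -[2^-1]powR_inv1// -powRrM mulN1r powRN.
  rewrite h exprVn le_eqVlt; apply/orP; left; apply/eqP;
field.
  by rewrite !expf_neq0 ?gt_eqF ?powR_gt0.
- move=> z ez; have [|k /andP[kz zk]] := @dyadic_above _ (enorm z) eps.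
    by rewrite e0.
  exists k; first by rewrite /eball/= /rho mulrCA -exprS.
  by apply: dens_le => //; exact: ltW.
Qed.

(** On the layer where |z| is between r 2^-(k+1) and rho = r 2^-k, |z|^2 times the
    density is at most C0 rho^2/(rho/2)^(N+2s), while the volume is at most
    (2 rho)^N. *)
Lemma sqr_dens_eball_le : exists2 C, 0 < C & forall r, 0 < r ->
  (\int[m]_(z in [set z | (0 < enorm z <= r)%R]) (enorm z ^+ 2 * dens z)%:E <=
   (C * r `^ (2 - 2 * s))%:E)%E.
Proof.
have s2 : 0 < 2 - 2 * s by have := s1; lra.
have /andP[q0 q1] := half_powR s2.
pose K := C0 * 4 ^+ N * 2 `^ (2 * s).
have K0 : 0 < K by apply: mulr_gt0; [apply: mulr_gt0 => //; exact: exprn_gt0|exact: powR_gt0].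
exists (K / (1 - 2^-1 `^ (2 - 2 * s))); first by rewrite divr_gt0// subr_gt0.
move=> r r0.
have mA : measurable [set z : 'rV[R]_N | 0 < enorm z <= r].
  rewrite (_ : mkset _ = enorm @^-1` `]0, r]%classic); last first.
    by apply/seteqP; split=> z /=; rewrite in_itv/=.
  by rewrite -[X in measurable X]setTI; exact: measurable_enorm.
pose rho k := r * 2^-1 ^+ k.
have rho0 k : 0 < rho k by rewrite mulr_gt0// exprn_gt0.
rewrite mulrAC.
apply: (@integral_layers_le _ _ _ _ _ _ (fun k => eball (rho k))
  (fun k => rho k ^+ 2 * (C0 / (rho k / 2) `^ nu))) => //=.
- apply: measurable_funTS; apply: measurable_funM; last exact: measurable_dens.
  by apply: measurable_funX; exact: measurable_enorm.
- by move=> z _; rewrite mulr_ge0 ?sqr_ge0// dens_ge0.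
- by move=> k; exact: measurable_eball.
- by move=> k; rewrite mulr_ge0 ?sqr_ge0// divr_ge0 ?powR_ge0// ltW.
- by rewrite mulr_ge0 ?powR_ge0// ltW.
- by rewrite q0.
- move=> k; apply: (@le_trans _ _
      ((rho k ^+ 2 * (C0 / (rho k / 2) `^ nu))%:E * ((2 * rho k) ^+ N)%:E)%E).
    rewrite lee_wpmul2l//.
      by rewrite lee_fin mulr_ge0 ?sqr_ge0// divr_ge0 ?powR_ge0// ltW.
    by apply: lebesgue_eball_le; rewrite ltW.
  have -> : K * r `^ (2 - 2 * s) * 2^-1 `^ (2 - 2 * s) ^+ k =
      K * rho k `^ (2 - 2 * s).
    by rewrite -mulrA -powR_exprn// -powRM ?exprn_ge0// ltW.
  rewrite -EFinM lee_fin powR_nu ?divr_gt0// powRM ?invr_ge0 ?(ltW (rho0 _))//.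
  rewrite powRB ?(gt_eqF (rho0 _)) ?implybT// powR_mulrn ?(ltW (rho0 _))//.
  have h : (2^-1 : R) `^ (2 * s) = (2 `^ (2 * s))^-1.
    by rewrite -[2^-1]powR_inv1// -powRrM mulN1r powRN.
  have h4 : (4 : R) ^+ N = 2 ^+ N * 2 ^+ N by rewrite -exprMn -natrM.
  move: (rho k) (rho0 k) => p p0; rewrite h /K h4 !exprMn exprVn le_eqVlt.
  apply/orP; left; apply/eqP;
field.
  by rewrite !expf_neq0 ?gt_eqF ?powR_gt0.
- move=> z zr; have [k /andP[kz zk]] := dyadic_below zr.
  have z0 : 0 < enorm z by case/andP : zr.
  exists k; first by [].
  apply: ler_pM; rewrite ?sqr_ge0 ?dens_ge0//.
    by rewrite ler_sqr ?nnegrE ?(ltW z0)// (le_trans _ zk)// ltW.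
  apply: dens_le; first by rewrite divr_gt0.
  by rewrite /rho -mulrA -exprSr ltW.
Qed.

End kernel.

(** * Integrals against the kernel over truncated cones *)

Section cone_int.
Context {R : realType} {N : nat}.
Variables (s alpha : R).
Hypothesis s01 : 0 < s < 1.
Hypothesis ha : 0 < alpha <= pi / 2.
Implicit Types (x y z w p : 'rV[R]_N) (M : 'M[R]_N) (b r t eps K : R).
Implicit Types (f g h : 'rV[R]_N -> R).

Local Notation m := (lebesgue_rV R N).
Local Notation dens := (@mu_density R N s).
Local Notation tcone eps y := (cone alpha eps%:E +oo y).

Definition bounded_measurable f :=
  measurable_fun setT f /\ exists b, forall z, `|f z| <= b.

Lemma bounded_measurableD f g : bounded_measurable f -> bounded_measurable g ->
  bounded_measurable (fun z => f z + g z).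
Proof.
move=> [mf [a fa]] [mg [b gb]]; split; first exact: measurable_funD.
by exists (a + b) => z; rewrite (le_trans (ler_normD _ _))// lerD.
Qed.

Lemma bounded_measurableZ k f : bounded_measurable f ->
  bounded_measurable (fun z => k * f z).
Proof.
move=> [mf [a fa]]; split; first exact: measurable_funM.
by exists (`|k| * a) => z; rewrite normrM ler_wpM2l.
Qed.

Lemma bounded_measurable_mulmx M f : bounded_measurable f ->
  bounded_measurable (fun z => f (z *m M)).
Proof.
move=> [mf [a fa]]; split; last by exists a.
exact: measurableT_comp mf (measurable_mulmx_rV M).
Qed.

Definition cone_int f y eps := \int[m]_(z in tcone eps y) (f z * dens z).

Section fixed_cone.
Variables (y : 'rV[R]_N) (eps : R).
Hypotheses (y1 : usphere y) (e0 : 0 < eps).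

Let mC : measurable (tcone eps y).
Proof. by apply: measurable_cone => //; exact: ltW. Qed.

Let mfd f : measurable_fun setT f ->
  measurable_fun setT (fun z => f z * dens z).
Proof. by move=> mf; apply: measurable_funM => //; exact: measurable_dens. Qed.

Lemma integrable_cone f : bounded_measurable f ->
  m.-integrable (tcone eps y) (EFin \o (fun z => f z * dens z)).
Proof.
move=> [mf [b fb]]; have b0 : 0 <= b by rewrite (le_trans _ (fb 0)).
have mdens := @measurable_dens R N s.
have md : m.-integrable (tcone eps y) (EFin \o dens).
  apply/integrableP; split.
    by apply/measurable_EFinP; apply: measurable_funTS.
  have T := @dens_tail_fin R N s s01 eps e0; apply: le_lt_trans T.
  under eq_integral => z _ do rewrite /= ger0_norm ?dens_ge0//.
  apply: ge0_subset_integral => //.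
  - rewrite (_ : mkset _ = enorm @^-1` `]eps, +oo[%classic); last first.
      by apply/seteqP; split=> z /=; rewrite in_itv/= andbT.
    by rewrite -[X in measurable X]setTI; exact: measurable_enorm.
  - by apply/measurable_EFinP; apply: measurable_funTS.
  - by move=> z _; rewrite lee_fin dens_ge0.
  - by move=> z; rewrite (coneE ha (ltW e0) y1) => -[].
apply: (@le_integrable _ _ _ _ _ mC _ (fun z => b%:E * (EFin \o dens) z)%E).
- by apply/measurable_EFinP; apply: measurable_funTS; exact: mfd.
- move=> z _ /=; rewrite lee_fin !normrM.
  by rewrite ler_wpM2r// (le_trans (fb z))// ler_norm.
- exact: integrableZl.
Qed.

Lemma cone_intD f g : bounded_measurable f -> bounded_measurable g ->
  cone_int (fun z => f z + g z) y eps = cone_int f y eps + cone_int g y eps.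
Proof.
move=> hf hg; rewrite /cone_int -RintegralD//; try exact: integrable_cone.
by apply: eq_Rintegral => z _; rewrite mulrDl.
Qed.

Lemma cone_intZ k f : bounded_measurable f ->
  cone_int (fun z => k * f z) y eps = k * cone_int f y eps.
Proof.
move=> hf; rewrite /cone_int -RintegralZl//; last exact: integrable_cone.
by apply: eq_Rintegral => z _; rewrite mulrA.
Qed.

Lemma le_cone_int f g : bounded_measurable f -> bounded_measurable g ->
  (forall z, tcone eps y z -> f z <= g z) ->
  cone_int f y eps <= cone_int g y eps.
Proof.
move=> hf hg fg; apply: le_Rintegral => //; try exact: integrable_cone.
by move=> z Cz; rewrite ler_wpM2r ?dens_ge0// fg.
Qed.

Lemma cone_int_EFin f : bounded_measurable f ->
  (cone_int f y eps)%:E = (\int[m]_(z in tcone eps y) (f z * dens z)%:E)%E.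
Proof.
by move=> hf; rewrite fineK//; apply: integrable_fin_num => //; exact: integrable_cone.
Qed.

Lemma cone_int_orth M f : orthogonal M -> bounded_measurable f ->
  cone_int (fun z => f (z *m M)) y eps = cone_int f (y *m M) eps.
Proof.
move=> oM hf; have [mf _] := hf; rewrite /cone_int /Rintegral; congr fine.
have mM := measurable_mulmx_rV M.
pose nu := measure_function_pushforward__canonical__measure_function_Measure m mM.
have mC' : measurable (tcone eps (y *m M)).
  exact: (measurable_cone ha (ltW e0) (usphere_orth oM y1)).
have CE : (fun z => z *m M) @^-1` (tcone eps (y *m M)) = tcone eps y.
  by apply/seteqP; split=> z; rewrite /preimage/= => /(cone_orth _ _ _ _ _ oM).
pose F z := (f z * dens z)%:E.
have mF : measurable_fun setT F by apply/measurable_EFinP; exact: mfd.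
have FE z : (F \o (fun z => z *m M)) z = (f (z *m M) * dens z)%:E.
  by rewrite /F/= dens_orth.
have iF : m.-integrable ((fun z => z *m M) @^-1` (tcone eps (y *m M)))
    (F \o (fun z => z *m M)).
  rewrite CE; apply: eq_integrable (integrable_cone (bounded_measurable_mulmx M hf)) => //.
transitivity (\int[m]_(z in tcone eps y) (F \o (fun z => z *m M)) z)%E.
  by apply: eq_integral => z _; rewrite FE.
have := integral_pushforward mM mF iF mC'; rewrite CE => <-.
by apply: (eq_measure_integral m) => A mA _; exact: lebesgue_rV_orth.
Qed.

End fixed_cone.

(** The half-turn about [y] maps the cone to itself and reverses the component of
    [p] orthogonal to [y]. *)
Lemma cone_int_axis f y p eps : usphere y -> 0 < eps ->
  (forall M z, orthogonal M -> f (z *m M) = f z) ->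
  (forall q, bounded_measurable (fun z => inner q z * f z)) ->
  cone_int (fun z => inner p z * f z) y eps =
  inner p y * cone_int (fun z => inner y z * f z) y eps.
Proof.
move=> y1 e0 fM fb; have oF := orthogonal_axis_flip (usphere_inner y1).
have yF : y *m axis_flip y = y.
  rewrite axis_flipE (usphere_inner y1) mulr1 -[X in _ - X]scale1r -scalerBl.
  by rewrite (_ : 2 - 1 = 1) ?scale1r//; ring.
have := cone_int_orth y1 e0 oF (fb p); rewrite yF => flip.
have : cone_int (fun z => inner p z * f z + inner p (z *m axis_flip y) * f (z *m axis_flip y)) y eps
    = 2 * cone_int (fun z => inner p z * f z) y eps.
  rewrite cone_intD//; last exact: (bounded_measurable_mulmx (axis_flip y) (fb p)).
  by rewrite flip; ring.
have -> : (fun z => inner p z * f z + inner p (z *m axis_flip y) * f (z *m axis_flip y)) =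
    (fun z => (2 * inner p y) * (inner y z * f z)).
  apply/funext => z; rewrite fM// axis_flipE !innerE (innerC z y); ring.
rewrite cone_intZ// => h; lra.
Qed.

Lemma le_cone_int_eps f y e1 e2 : usphere y -> 0 < e1 <= e2 ->
  bounded_measurable f -> (forall z, tcone e1 y z -> 0 <= f z) ->
  cone_int f y e2 <= cone_int f y e1.
Proof.
move=> y1 /andP[e10 e12] hf f0; have e20 : 0 < e2 by exact: lt_le_trans e12.
have [mf _] := hf.
rewrite -lee_fin !cone_int_EFin//; apply: ge0_subset_integral.
- by apply: measurable_cone => //; exact: ltW.
- by apply: measurable_cone => //; exact: ltW.
- apply/measurable_EFinP; apply: measurable_funTS.
  by apply: measurable_funM => //; exact: measurable_dens.
- by move=> z Cz; rewrite lee_fin mulr_ge0 ?dens_ge0// f0.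
- move=> z; rewrite (coneE ha (ltW e10) y1) (coneE ha (ltW e20) y1) => -[h ?].
  by split=> //; exact: le_lt_trans h.
Qed.

Lemma cone_int_eps f y e r : usphere y -> 0 < e < r ->
  (forall z, enorm z <= r -> f z = 0) ->
  cone_int f y e = cone_int f y r.
Proof.
move=> y1 /andP[e0 er] f0; have r0 : 0 < r by exact: lt_trans er.
rewrite /cone_int [LHS]Rintegral_mkcond [RHS]Rintegral_mkcond.
congr Rintegral; apply/funext => z; rewrite !patchE.
have [zr|rz] := leP (enorm z) r; first by rewrite f0// mul0r; do 2 case: ifP.
suff -> : (z \in tcone e y) = (z \in tcone r y) by [].
apply/idP/idP; rewrite !inE (coneE ha (ltW e0) y1) (coneE ha (ltW r0) y1) => -[_ h]; split=> //.
exact: lt_trans rz.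
Qed.

Lemma indic_eball r z : \1_(eball r) z = if enorm z <= r then 1 else 0 :> R.
Proof.
rewrite indicE (_ : (z \in eball r) = (enorm z <= r)); first by case: ifP.
by apply/idP/idP; rewrite in_setE.
Qed.

Lemma bounded_measurable_eball r f b : measurable_fun setT f ->
  (forall z, enorm z <= r -> `|f z| <= b) ->
  bounded_measurable (fun z => f z * \1_(eball r) z).
Proof.
move=> mf fb; split.
  apply: measurable_funM => //; apply: measurable_indic; exact: measurable_eball.
exists (Num.max b 0) => z; rewrite indic_eball; case: (leP (enorm z) r) => h.
  by rewrite mulr1 le_max fb.
by rewrite mulr0 normr0 le_max lexx orbT.
Qed.

Lemma bounded_measurable_eballC r f b : measurable_fun setT f ->
  (forall z, `|f z| <= b) ->
  bounded_measurable (fun z => f z * (1 - \1_(eball r) z)).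
Proof.
move=> mf fb; split.
  apply: measurable_funM => //; apply: measurable_funB => //.
  apply: measurable_indic; exact: measurable_eball.
exists b => z; rewrite indic_eball; case: (leP (enorm z) r) => h.
  by rewrite subrr mulr0 normr0 (le_trans _ (fb 0)).
by rewrite subr0 mulr1.
Qed.

Lemma bounded_measurable_inner_eball r q :
  bounded_measurable (fun z => inner q z * \1_(eball r) z).
Proof.
apply: (@bounded_measurable_eball _ _ (enorm q * r)); first exact: measurable_inner.
move=> z zr; rewrite (le_trans (normr_inner_le _ _))// ler_wpM2l ?enorm_ge0//.
Qed.

Lemma bounded_measurable_sqr_eball r :
  bounded_measurable (fun z => enorm z ^+ 2 * \1_(eball r) z).
Proof.
apply: (@bounded_measurable_eball _ _ (r ^+ 2)).
  by apply: measurable_funX; exact: measurable_enorm.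
move=> z zr; rewrite ger0_norm ?sqr_ge0// ler_sqr ?nnegrE ?enorm_ge0//.
by apply: le_trans zr; exact: enorm_ge0.
Qed.

Lemma cone_int_sqr_eball_le : exists2 C, 0 < C & forall r y eps, 0 < r ->
  usphere y -> 0 < eps ->
  cone_int (fun z => enorm z ^+ 2 * \1_(eball r) z) y eps <= C * r `^ (2 - 2 * s).
Proof.
have [C C0 CE] := @sqr_dens_eball_le R N s s01; exists C => // r y eps r0 y1 e0.
rewrite -lee_fin; apply: le_trans (CE r r0).
rewrite cone_int_EFin//; last exact: bounded_measurable_sqr_eball.
rewrite [leLHS]integral_mkcond [leRHS]integral_mkcond.
have mg : measurable_fun setT (fun z : 'rV[R]_N => (enorm z ^+ 2 * dens z)%:E).
  apply/measurable_EFinP; apply: measurable_funM; last exact: measurable_dens.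
  by apply: measurable_funX; exact: measurable_enorm.
apply: ge0_le_integral => //.
- move=> z _; rewrite patchE; case: ifP => // _; rewrite lee_fin.
  by rewrite mulr_ge0 ?dens_ge0// mulr_ge0 ?sqr_ge0//.
- apply/(measurable_restrictT _ _).1.
    by apply: measurable_cone => //; exact: ltW.
  apply: measurable_funTS; apply/measurable_EFinP.
  apply: measurable_funM; last exact: measurable_dens.
  by have [] := bounded_measurable_sqr_eball r.
- apply/(measurable_restrictT _ _).1; last exact: measurable_funTS.
  rewrite (_ : mkset _ = enorm @^-1` `]0, r]%classic); last first.
    by apply/seteqP; split=> z /=; rewrite in_itv/=.
  by rewrite -[X in measurable X]setTI; exact: measurable_enorm.
- move=> z _; rewrite !patchE; case: ifPn => [|_]; last first.
    by case: ifP => // _; rewrite lee_fin mulr_ge0 ?sqr_ge0 ?dens_ge0.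
  rewrite inE (coneE ha (ltW e0) y1) => -[ez _]; rewrite indic_eball.
  have z0 : 0 < enorm z by exact: lt_trans ez.
  case: (leP (enorm z) r) => zr; last first.
    by rewrite mulr0 mul0r; case: ifP => // _; rewrite lee_fin mulr_ge0 ?sqr_ge0 ?dens_ge0.
  by rewrite mulr1 mem_set//= z0.
Qed.

(** Each cone contains, beyond distance [b] from the apex, a cube centred at 4b y
    whose side does not depend on the axis y, and the density is bounded below
    there. *)
Lemma cone_int_tail_ge b : (0 < N)%N -> 0 < b -> exists2 c, 0 < c &
  forall y eps, usphere y -> 0 < eps <= b ->
  c <= cone_int (fun z => 1 - \1_(eball b) z) y eps.
Proof.
move=> N0 b0; have /andP[c0 c1] := cos_cone_ge0 ha.
pose t := 4 * b; pose eta := (1 - cos alpha) / 4 * t.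
have t0 : 0 < t by rewrite mulr_gt0.
have eta0 : 0 < eta by rewrite !mulr_gt0 ?subr_gt0.
pose a := eta / N%:R; have a0 : 0 < a by rewrite divr_gt0// ltr0n.
pose k := @const_C R N s / (2 * t) `^ (N%:R + 2 * s).
have k0 : 0 < k.
  by apply: divr_gt0; [exact: const_C_gt0|apply: powR_gt0; exact: mulr_gt0].
exists (k * (2 * a) ^+ N).
  by apply: mulr_gt0 => //; apply: exprn_gt0; exact: mulr_gt0.
move=> y eps y1 /andP[e0 eb].
have sub z : cube (t *: y) a z -> tcone eps y z /\ t / 2 < enorm z <= 2 * t.
  move=> zc; apply: ball_sub_cone => //; first exact: ltW.
    by rewrite /t; lra.
  have aE : N%:R * a = eta by rewrite /a mulrC divfK// pnatr_eq0 -lt0n.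
  rewrite -/eta -aE; apply: enorm_le_coord => i.
  by have := zc i; rewrite !mxE.
have bm : bounded_measurable (fun z => 1 - \1_(eball b) z).
  have := @bounded_measurable_eballC b (cst 1) 1 _ _.
  rewrite (_ : (fun z => _ * _) = (fun z => 1 - \1_(eball b) z)); last first.
    by apply/funext => z; rewrite mul1r.
  by apply => // z; rewrite normr1.
rewrite -lee_fin cone_int_EFin// EFinM -(lebesgue_cube (t *: y) (ltW a0)).
rewrite -integral_cst; last exact: measurable_cube.
apply: (@le_trans _ _ (\int[m]_(z in cube (t *: y) a) ((1 - \1_(eball b) z) * dens z)%:E)%E).
  apply: ge0_le_integral => //.
  - exact: measurable_cube.
  - by move=> z _; rewrite lee_fin ltW.
  - apply: measurable_funTS; apply/measurable_EFinP.
  apply: measurable_funM; last exact: measurable_dens.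
    by have [] := bm.
  - move=> z /sub[_ /andP[z1 z2]]; rewrite /t in z1.
    rewrite lee_fin indic_eball (_ : (enorm z <= b) = false) ?subr0 ?mul1r; last first.
      by apply/negbTE; rewrite -ltNge; lra.
    by apply: dens_ge => //; lra.
apply: ge0_subset_integral.
- exact: measurable_cube.
- by apply: measurable_cone => //; exact: ltW.
- apply: measurable_funTS; apply/measurable_EFinP.
  apply: measurable_funM; last exact: measurable_dens.
  by have [] := bm.
- by move=> z _; rewrite lee_fin mulr_ge0 ?dens_ge0// indic_eball.
- by move=> z zc; have [] := sub z zc.
Qed.

End cone_int.

(** * The operator at functions touched by a paraboloid *)

Section operator_limit.
Context {R : realType}.
Implicit Types (c d L : R -> R).

Lemma cvg_nonincreasing_sum c d L (r k k' a b : R) : 0 < r ->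
  (forall e1 e2, 0 < e1 <= e2 -> e2 < r -> c e2 <= c e1) ->
  (forall e1 e2, 0 < e1 <= e2 -> e2 < r -> d e2 <= d e1) ->
  (forall e, 0 < e < r -> d e <= b) ->
  (forall e, 0 < e < r -> L e = k * c e + (k' * d e + a)) ->
  cvg ((L e)%:E @[e --> 0^'+]).
Proof.
move=> r0 cmon dmon db LE.
have /cvg_ex[lc hc] : cvg ((c e)%:E @[e --> 0^'+]).
  apply/cvg_ex; eexists; apply: (nonincreasing_at_right_cvge (BLeft r)).
    by rewrite bnd_simp.
  move=> e1 e2; rewrite !in_itv/= => /andP[e10 e1r] /andP[e20 e2r] e12.
  by rewrite lee_fin cmon// e10.
have [ld hd] : exists l : R, d e @[e --> 0^'+] --> l.
  exists (sup (d @` [set` Interval (BRight 0) (BLeft r)])).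
  apply: nonincreasing_at_right_cvgr.
  - by rewrite bnd_simp.
  - move=> e1 e2; rewrite !in_itv/= => /andP[e10 e1r] /andP[e20 e2r] e12.
    by rewrite dmon ?e10 ?e20.
  - by exists b => _ [e + <-]; rewrite /= in_itv/=; exact: db.
have hda : (k' * d e + a)%:E @[e --> 0^'+] --> (k' * ld + a)%:E.
  apply: cvg_EFin; first by near=> e.
  by apply: cvgD; [apply: cvgMl_tmp|exact: cvg_cst].
have kc : (k%:E * (c e)%:E)%E @[e --> 0^'+] --> (k%:E * lc)%E by exact: cvgeZl.
apply/cvg_ex; exists (k%:E * lc + (k' * ld + a)%:E)%E.
have def : (k%:E * lc +? (k' * ld + a)%:E)%E by exact: fin_num_adde_defl.
apply: cvg_trans (cvgeD def kc hda); apply: near_eq_cvg; near=> e.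
by rewrite LE//; apply/andP; split; near: e; [exact: nbhs_right_gt|exact: nbhs_right_lt].
Unshelve. all: by end_near. Qed.

End operator_limit.

Section paraboloid.
Context {R : realType} {N : nat}.
Variables (s alpha : R) (rot : 'rV[R]_N -> 'rV[R]_N -> 'M[R]_N).
Hypothesis s01 : 0 < s < 1.
Hypothesis ha : 0 < alpha <= pi / 2.
Hypothesis hrot : is_rotation_family rot.
Implicit Types (x y z w p : 'rV[R]_N) (M : 'M[R]_N) (b r t eps K : R).
Implicit Types (f g h : 'rV[R]_N -> R).

Local Notation J := (@cone_int R N s alpha).

Lemma rot_orth y' y : usphere y' -> usphere y ->
  orthogonal (rot y' y) /\ y *m rot y' y = y'.
Proof. by move=> y'1 y1; have [[oM _] yM _ _] := hrot y'1 y1. Qed.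

(** The increments, from the contact point, of a test function: a paraboloid within
    distance [r], and beyond it the solution, whose increments are [h]. *)
Definition paraboloid_incr p K r h z : R :=
  (inner p z + K * enorm z ^+ 2) * \1_(eball r) z + h z * (1 - \1_(eball r) z).

Lemma bounded_measurable_paraboloid p K r h : bounded_measurable h ->
  bounded_measurable (paraboloid_incr p K r h).
Proof.
move=> [mh [b hb]].
rewrite (_ : paraboloid_incr p K r h = fun z => (inner p z * \1_(eball r) z +
    K * (enorm z ^+ 2 * \1_(eball r) z)) + h z * (1 - \1_(eball r) z)); last first.
  by apply/funext => z; rewrite /paraboloid_incr; ring.
apply: bounded_measurableD; last exact: bounded_measurable_eballC hb.
apply: bounded_measurableD; first exact: bounded_measurable_inner_eball.
by apply: bounded_measurableZ; exact: bounded_measurable_sqr_eball.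
Qed.

Let c r y := J (fun z => inner y z * \1_(eball r) z) y.
Let d r y := J (fun z => enorm z ^+ 2 * \1_(eball r) z) y.

Let indic_eball_orth r M z : orthogonal M -> \1_(eball r) (z *m M) = \1_(eball r) z :> R.
Proof. by move=> oM; rewrite !indic_eball enorm_orth. Qed.

Let J_paraboloid p K r h y eps : bounded_measurable h -> usphere y -> 0 < eps < r ->
  J (paraboloid_incr p K r h) y eps = inner p y * c r y eps + K * d r y eps +
  J (fun z => h z * (1 - \1_(eball r) z)) y r.
Proof.
move=> [mh [b hb]] y1 /andP[e0 er].
rewrite (_ : paraboloid_incr p K r h = fun z => (inner p z * \1_(eball r) z +
    K * (enorm z ^+ 2 * \1_(eball r) z)) + h z * (1 - \1_(eball r) z)); last first.
  by apply/funext => z; rewrite /paraboloid_incr; ring.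
have b1 := bounded_measurable_inner_eball r p.
have b2 := @bounded_measurable_sqr_eball R N r.
have b3 := bounded_measurable_eballC r mh hb.
have b4 := bounded_measurableZ K b2.
rewrite cone_intD//; last exact: bounded_measurableD.
rewrite cone_intD// cone_intZ//; congr (_ + _ + _).
  apply: cone_int_axis => //; first by move=> M z; exact: indic_eball_orth.
  by move=> q; exact: bounded_measurable_inner_eball.
apply: cone_int_eps => //; first by rewrite e0.
by move=> z zr; rewrite indic_eball zr subrr mulr0.
Qed.

Let c_rot r y y' eps : usphere y -> usphere y' -> 0 < eps -> c r y' eps = c r y eps.
Proof.
move=> y1 y'1 e0; have [oM yM] := rot_orth y'1 y1.
rewrite /c -{2}yM -cone_int_orth//; last exact: bounded_measurable_inner_eball.
by congr J; apply/funext => z; rewrite -{1}yM inner_orth// indic_eball_orth.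
Qed.

Let d_rot r y y' eps : usphere y -> usphere y' -> 0 < eps -> d r y' eps = d r y eps.
Proof.
move=> y1 y'1 e0; have [oM yM] := rot_orth y'1 y1.
rewrite /d -{1}yM -cone_int_orth//; last exact: bounded_measurable_sqr_eball.
by congr J; apply/funext => z; rewrite enorm_orth// indic_eball_orth.
Qed.

(** As eps decreases, the first-order terms contribute a multiple <p, y + y'> of a
    quantity that can only grow, as <y,z> >= 0 on T(y), and the second-order terms
    contribute a bounded monotone quantity: the sum has a limit, maybe infinite. *)
Lemma cvg_cone_int_paraboloid p K r h y y' : 0 < r -> bounded_measurable h ->
  usphere y -> usphere y' ->
  cvg ((J (paraboloid_incr p K r h) y eps +
        J (paraboloid_incr p K r h) y' eps)%:E @[eps --> 0^'+]).
Proof.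
move=> r0 hh y1 y'1; have [C C0 CE] := @cone_int_sqr_eball_le R N s alpha s01 ha.
have ind0 z : 0 <= \1_(eball r) z :> R by rewrite indic_eball; case: ifP.
apply: (@cvg_nonincreasing_sum _ (c r y) (d r y) _ r (inner p y + inner p y') (2 * K)
  (J (fun z => h z * (1 - \1_(eball r) z)) y r + J (fun z => h z * (1 - \1_(eball r) z)) y' r)
  (C * r `^ (2 - 2 * s)) r0).
- move=> e1 e2 e12 e2r; apply: le_cone_int_eps => //.
    exact: bounded_measurable_inner_eball.
  have /andP[c0 _] := cos_cone_ge0 ha; have /andP[e10 _] := e12.
  move=> z; rewrite (coneE ha (ltW e10) y1) => -[_ yz].
  by rewrite mulr_ge0// (le_trans _ (ltW yz))// mulr_ge0// enorm_ge0.
- move=> e1 e2 e12 e2r; apply: le_cone_int_eps => //.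
    exact: bounded_measurable_sqr_eball.
  by move=> z _; rewrite mulr_ge0 ?sqr_ge0.
- by move=> e /andP[e0 er]; exact: CE.
- move=> e er; have /andP[e0 _] := er.
  by rewrite !J_paraboloid// (c_rot r y1 y'1 e0) (d_rot r y1 y'1 e0); ring.
Qed.

(** The rotation in the operator moves the opposite cone -T(y) to -T(y'), and
    Lebesgue measure does not see it. *)
Lemma cone_integralE (U : 'rV[R]_N -> R) g x y y' eps :
  (forall z, U (x + z) - U x = g z) -> bounded_measurable g ->
  usphere y -> usphere y' -> 0 < eps ->
  cone_integral s alpha rot U x y y' eps = (J g y eps + J g (- y') eps)%:E.
Proof.
move=> Ug hg y1 y'1 e0; have [oM yM] := rot_orth y'1 y1.
have oN := orthogonalN oM.
rewrite -yM -mulmxN -cone_int_orth// -cone_intD//; last first.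
  exact: bounded_measurable_mulmx.
rewrite cone_int_EFin//; last first.
  by apply: bounded_measurableD => //; exact: bounded_measurable_mulmx.
apply: eq_integral => z _; congr (_ * _)%:E.
by rewrite yM -!Ug mulmxN; ring.
Qed.

(** With [y0] an almost optimal first direction, the second direction -y turns the
    two cones of the operator into T(y0) and T(y), and [y] remains free. *)
Lemma Lop_ge0_near (U : 'rV[R]_N -> R) x p K r h delta : 0 < r ->
  (forall z, U (x + z) - U x = paraboloid_incr p K r h z) -> bounded_measurable h ->
  (0 <= Lop s alpha rot U x)%E -> 0 < delta ->
  exists2 y0, usphere y0 & forall y, usphere y -> \forall eps \near 0^'+,
    - delta < J (paraboloid_incr p K r h) y0 eps + J (paraboloid_incr p K r h) y eps.
Proof.
move=> r0 Ug hh L0 d0.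
have : ((- delta)%:E < Lop s alpha rot U x)%E.
  by apply: lt_le_trans L0; rewrite lte_fin oppr_lt0.
move=> /ereal_sup_gt[_ [y0 y01 <-]] y0I; exists y0 => // y y1.
have := lt_le_trans y0I (ereal_inf_lbound _); move/(_ _ (ex_intro2 _ _ (- y) (usphereN y1) erefl)).
set L := lim _ => Ld.
have hg := bounded_measurable_paraboloid p K r hh.
have IE eps : 0 < eps -> cone_integral s alpha rot U x y0 (- y) eps =
    (J (paraboloid_incr p K r h) y0 eps + J (paraboloid_incr p K r h) y eps)%:E.
  by move=> e0; rewrite (cone_integralE Ug hg y01 (usphereN y1) e0) opprK.
have cI : cone_integral s alpha rot U x y0 (- y) eps @[eps --> 0^'+] --> L.
  apply/cvg_ex; have /cvg_ex[l hl] := @cvg_cone_int_paraboloid p K r h y0 y r0 hh y01 y1.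
  exists l; apply: cvg_trans hl; apply: near_eq_cvg; near=> e.
  by rewrite IE//; near: e; exact: nbhs_right_gt.
have : \forall eps \near 0^'+, ((- delta)%:E < cone_integral s alpha rot U x y0 (- y) eps)%E.
  exact: (cI _ (open_ereal_gt' Ld)).
move=> near_I; near=> e.
have e0 : 0 < e by near: e; exact: nbhs_right_gt.
rewrite -lte_fin -IE//; near: e; exact: near_I.
Unshelve. all: by end_near. Qed.

End paraboloid.

(** * Paraboloids as test functions *)

Lemma continuous_inner (R : realType) (N : nat) (T : topologicalType)
    (f g : T -> 'rV[R]_N) : continuous f -> continuous g ->
  continuous (fun t => inner (f t) (g t)).
Proof.
move=> cf cg; rewrite /inner; apply: continuous_big; first exact: add_continuous.
move=> i _ t; apply: cvgM.
  exact: (@continuous_comp _ _ _ f (fun x : 'rV[R]_N => x ord0 i) t (cf t)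
    (@coord_continuous R 1 N ord0 i (f t))).
exact: (@continuous_comp _ _ _ g (fun x : 'rV[R]_N => x ord0 i) t (cg t)
    (@coord_continuous R 1 N ord0 i (g t))).
Qed.

Section test_functions.
Context {R : realType} {N : nat}.
Implicit Types (x y z v p : 'rV[R]_N) (a b r K : R).

Definition paraboloid a p K x0 x : R :=
  a + inner p (x - x0) + K * inner (x - x0) (x - x0).

Lemma derive_paraboloid a p K x0 x v :
  derivable (paraboloid a p K x0) x v /\
  'D_v (paraboloid a p K x0) x = inner p v + 2 * K * inner v (x - x0).
Proof.
have lim_quot : (fun h : R => h^-1 *: ((paraboloid a p K x0 \o shift x) (h *: v) -
    paraboloid a p K x0 x)) @ 0^' --> inner p v + 2 * K * inner v (x - x0).
  have H : (inner p v + 2 * K * inner v (x - x0)) + h * (K * inner v v) @[h --> 0^'] -->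
      inner p v + 2 * K * inner v (x - x0).
    rewrite -[X in _ --> X]addr0 -[X in _ --> _ + X](mul0r (K * inner v v)).
    apply: cvgD; first exact: cvg_cst.
    by apply: cvgMr_tmp; exact: cvg_within.
  apply: cvg_trans H; apply: near_eq_cvg; near=> h.
  have h0 : h != 0 by near: h; exact: nbhs_dnbhs_neq.
  rewrite /= /paraboloid.
  have -> : h *: v + x - x0 = h *: v + (x - x0) by rewrite addrA.
  move: (x - x0) => e; rewrite !innerE (innerC e v) -[RHS]/(h^-1 * _).
  by field.
split; first by apply/cvg_ex; eexists; exact: lim_quot.
exact: cvg_lim lim_quot.
Unshelve. all: by end_near. Qed.

Lemma C1_paraboloid a p K x0 : C1 (paraboloid a p K x0).
Proof.
move=> i; split=> [x|]; first by have [] := derive_paraboloid a p K x0 x (ebase i).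
rewrite (_ : (fun x => _) = (fun x => inner p (ebase i) + 2 * K * inner (ebase i) (x - x0))).
  have ci : continuous (fun x => inner (ebase i) (x - x0)).
    apply: (continuous_inner (f := fun _ => ebase i) (g := fun x => x - x0)).
      exact: cst_continuous.
    by move=> x; exact: (cvgB (@cvg_id _ _) (cvg_cst x0)).
  move=> x; exact: (cvgD (cvg_cst (inner p (ebase i))) (cvgMl_tmp (ci x))).
by apply/funext => x; have [] := derive_paraboloid a p K x0 x (ebase i).
Qed.

Lemma C2_paraboloid a p K x0 : C2 (paraboloid a p K x0).
Proof.
split=> [|i]; first exact: C1_paraboloid.
rewrite (_ : (fun x => _) = paraboloid (inner p (ebase i)) ((2 * K) *: ebase i) 0 x0).
  exact: C1_paraboloid.
apply/funext => x; have [_ ->] := derive_paraboloid a p K x0 x (ebase i).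
by rewrite /paraboloid innerZl mul0r addr0.
Qed.

Variables (s alpha : R) (rot : 'rV[R]_N -> 'rV[R]_N -> 'M[R]_N).

Lemma unif_continuous_continuous (u : 'rV[R]_N -> R) :
  unif_continuous u -> continuous u.
Proof.
move=> /unif_continuousP uc x A /nbhs_ballP[e /= e0 eA].
have [d d0 H] := uc e e0; apply/nbhs_ballP; exists d => // y xy.
by apply: eA; exact: (H (x, y)).
Qed.

Lemma bounded_funE (u : 'rV[R]_N -> R) : bounded_fun u ->
  exists2 b, 0 < b & forall x, `|u x| <= b.
Proof.
move=> [M [_ H]]; exists (Num.max M 0 + 1).
  by rewrite ltr_wpDl// le_max lexx orbT.
by move=> x; apply: H => //; rewrite ltr_pwDr// le_max lexx.
Qed.

Lemma bounded_measurable_incr (u : 'rV[R]_N -> R) x :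
  bounded_fun u -> unif_continuous u ->
  bounded_measurable (fun z => u (x + z) - u x).
Proof.
move=> /bounded_funE[b b0 ub] uc; split; last first.
  by exists (b + b) => z; rewrite (le_trans (ler_normB _ _))// lerD.
apply: measurable_funB => //.
under eq_fun do rewrite addrC.
apply: (measurableT_comp _ (measurable_addr_rV x)).
by apply: continuous_measurable_rV; exact: unif_continuous_continuous.
Qed.

(** Touching by the paraboloid of opening [k] may not be strict; a larger opening
    [K] with the same gradient makes it so. *)
Lemma subsolution_paraboloid D u x0 p k K r :
  viscosity_subsolution s alpha rot D u -> D x0 -> 0 < r -> k < K ->
  (forall z, u (x0 + z) - u x0 <= inner p z + k * enorm z ^+ 2) ->
  exists2 U : 'rV[R]_N -> R, (0 <= Lop s alpha rot U x0)%E &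
    forall z, U (x0 + z) - U x0 = paraboloid_incr p K r (fun z => u (x0 + z) - u x0) z.
Proof.
move=> [_ _ usub] Dx0 r0 kK ule.
pose phi := paraboloid (u x0) p K x0.
have phix : phi x0 = u x0.
  by rewrite /phi /paraboloid subrr -enorm_sqr enorm0 expr0n mulr0 addr0
    -(scale0r p) innerZr mul0r addr0.
eexists; first apply: (usub x0 r phi) => //.
- exact: C2_paraboloid.
- move=> z _ zx; have := ule (z - x0); rewrite (addrC x0) subrK lerBlDr => /le_lt_trans; apply.
  rewrite /phi /paraboloid -enorm_sqr addrC addrA ltrD2l ltr_pM2r// exprn_gt0//.
  by apply: enorm_gt0 => /eqP; rewrite subr_eq0 => /eqP.
move=> z.
have cb y : \1_(cball x0 r) (x0 + y) = \1_(eball r) y :> R.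
  rewrite !indicE; congr (_%:R); congr nat_of_bool.
  by apply/idP/idP; rewrite !in_setE /cball/eball/= addrC addKr.
have cbC y : \1_(~` cball x0 r) (x0 + y) = 1 - \1_(eball r) y :> R.
  by rewrite -cb !indicE in_setC; case: (_ \in cball _ _); rewrite ?subrr ?subr0.
have eball0 : \1_(eball r) (0 : 'rV[R]_N) = 1 :> R by rewrite indic_eball enorm0 ltW.
have := cb 0; have := cbC 0; rewrite addr0 eball0 subrr => -> ->.
rewrite cb cbC phix mul0r addr0 mul1r /phi /paraboloid /paraboloid_incr -enorm_sqr.
rewrite (_ : x0 + z - x0 = z); last by rewrite addrC addKr.
have [zr|zr] := leP (enorm z) r; rewrite indic_eball; first by rewrite zr; ring.
by rewrite leNgt zr/=; ring.
Qed.

End test_functions.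

(** * Comparison *)

Section comparison.
Context {R : realType} {N : nat}.
Implicit Types (x y z p : 'rV[R]_N) (D : set 'rV[R]_N) (u w : 'rV[R]_N -> R).
Implicit Types (e b c r : R).

Definition doubled u w e x y : R := u x + w y - inner (x - y) (x - y) / (2 * e).

Lemma bounded_set_enorm D : bounded_set D ->
  exists2 b, 0 < b & forall x, D x -> enorm x <= b.
Proof.
move=> [M [_ H]]; pose a := Num.max M 0 + 1.
have a0 : 0 < a by rewrite ltr_wpDl// le_max lexx orbT.
exists (N%:R * a + 1); first by rewrite ltr_wpDl// mulr_ge0// ltW.
move=> x Dx; apply: (@le_trans _ _ (N%:R * a)); last by rewrite lerDl.
apply: enorm_le_coord => i; have : `|x| <= a.
  by apply: H => //; rewrite /a ltr_pwDr// le_max lexx.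
apply: le_trans; rewrite [leRHS]/Num.norm/= mx_normrE.
by apply/bigmax_geP; right; exists (ord0, i).
Qed.

Lemma unif_continuous_enorm u e : unif_continuous u -> 0 < e ->
  exists2 d, 0 < d & forall x y, enorm (x - y) < d -> `|u x - u y| < e.
Proof.
move=> /unif_continuousP uc e0; have [d d0 H] := uc e e0; exists d => // x y xy.
have := H (x, y); rewrite -!ball_normE /=; apply.
exact: le_lt_trans (normr_le_enorm _) xy.
Qed.

Lemma compact_box b : compact [set x : 'rV[R]_N | forall i, `[- b, b]%classic (x ord0 i)].
Proof. by apply: (@rV_compact _ _ (fun=> `[- b, b]%classic)) => _; exact: segment_compact. Qed.

(** Off D x D the doubled function stays below one of its values on D x D, so its
    maximum over a compact set containing D x D is global. *)
Lemma doubled_max u w D e x1 : continuous u -> continuous w -> bounded_set D ->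
  D x1 ->
  (forall x y, ~ (D x /\ D y) -> doubled u w e x y < doubled u w e x1 x1) ->
  exists x0 y0, [/\ D x0, D y0 &
    forall x y, doubled u w e x y <= doubled u w e x0 y0].
Proof.
move=> cu cw /bounded_set_enorm[b b0 Db] Dx1 off.
pose A := [set x : 'rV[R]_N | forall i, `[- b, b]%classic (x ord0 i)].
have DA x : D x -> A x.
  move=> Dx i; rewrite /= in_itv/= -ler_norml.
  exact: le_trans (normr_coord_le _ _) (Db x Dx).
pose f (q : 'rV[R]_N * 'rV[R]_N) := doubled u w e q.1 q.2.
have cf : continuous f.
  have cd : continuous (fun q : 'rV[R]_N * 'rV[R]_N => q.1 - q.2).
    by move=> q; apply: cvgB; [exact: cvg_fst|exact: cvg_snd].
  move=> q; apply: cvgB; last first.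
    by apply: cvgMr_tmp; exact: (continuous_inner cd cd).
  apply: cvgD.
    exact: (@continuous_comp _ _ _ fst u q (@cvg_fst _ _ _ _ _) (cu q.1)).
  exact: (@continuous_comp _ _ _ snd w q (@cvg_snd _ _ _ _ _) (cw q.2)).
have [||[x0 y0] /set_mem [Ax0 Ay0] fmax] :=
    @compact_EVT_max _ _ f (A `*` A) _ (compact_setX (@compact_box b) (@compact_box b)).
- by exists (x1, x1); split; exact: DA.
- exact: continuous_subspaceT.
have f1 : doubled u w e x1 x1 <= doubled u w e x0 y0.
  by apply: (fmax (x1, x1)); rewrite inE; split; exact: DA.
have [[Dx0 Dy0]|] := pselect (D x0 /\ D y0); last first.
  by move/off/(le_lt_trans f1); rewrite ltxx.
exists x0, y0; split=> // x y; have [[Dx Dy]|nD] := pselect (D x /\ D y).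
  by apply: (fmax (x, y)); rewrite inE; split; exact: DA.
exact: le_trans (ltW (off x y nD)) f1.
Qed.

Lemma doubled_increment u w e x0 y0 x y :
  doubled u w e x y <= doubled u w e x0 y0 ->
  (u x - u x0) + (w y - w y0) <=
  (inner (x - y) (x - y) - inner (x0 - y0) (x0 - y0)) / (2 * e).
Proof. by rewrite /doubled mulrBl => h; lra. Qed.

Variables (s alpha : R) (rot : 'rV[R]_N -> 'rV[R]_N -> 'M[R]_N).
Hypothesis N0 : (0 < N)%N.
Hypothesis s01 : 0 < s < 1.
Hypothesis ha : 0 < alpha <= pi / 2.
Hypothesis hrot : is_rotation_family rot.

Local Notation J := (@cone_int R N s alpha).

Lemma comparison D u w : bounded_set D ->
  viscosity_subsolution s alpha rot D u -> viscosity_subsolution s alpha rot D w ->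
  (forall x, ~ D x -> u x + w x = 0) -> forall x, u x + w x <= 0.
Proof.
move=> bD subu subw uw0 x1; rewrite leNgt; apply/negP.
move ME : (u x1 + w x1) => M M0.
have Dx1 : D x1 by apply: contrapT => /uw0 h; move: M0; rewrite -ME h ltxx.
have [bu ucu _] := subu; have [bw ucw _] := subw.
have M4 : 0 < M / 4 by rewrite divr_gt0.
have [B B0 [uB wB]] : exists2 B, 0 < B & (forall x, `|u x| <= B) /\ (forall x, `|w x| <= B).
  have [a a0 ua] := bounded_funE bu; have [b b0 wb] := bounded_funE bw.
  exists (Num.max a b); first by rewrite lt_max a0.
  by split=> x; rewrite le_max ?ua// wb orbT.
have [d d0 [ud wd]] : exists2 d, 0 < d &
    (forall x y, enorm (x - y) < d -> `|u x - u y| < M / 4) /\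
    (forall x y, enorm (x - y) < d -> `|w x - w y| < M / 4).
  have [a a0 ua] := unif_continuous_enorm ucu M4.
  have [b b0 wb] := unif_continuous_enorm ucw M4.
  exists (Num.min a b); first by rewrite lt_min a0.
  by split=> x y; rewrite lt_min => /andP[h1 h2]; [exact: ua|exact: wb].
(* With this [e] the penalization is at least 2B, hence cancels u(x) + w(y), as soon
   as |x - y| >= d. *)
have [e e0 eE] : exists2 e, 0 < e & 2 * B * (2 * e) = d ^+ 2.
  exists (d ^+ 2 / (4 * B)); last by field; rewrite gt_eqF.
  by rewrite divr_gt0 ?exprn_gt0 ?mulr_gt0.
have e20 : 0 < 2 * e by exact: mulr_gt0.
have off x y : ~ (D x /\ D y) -> doubled u w e x y <= M / 4.
  move=> nD; have xy0 : 0 <= inner (x - y) (x - y) / (2 * e).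
    by rewrite divr_ge0 ?inner_ge0// mulr_ge0// ltW.
  have [dxy|xyd] := leP d (enorm (x - y)).
    have : 2 * B <= inner (x - y) (x - y) / (2 * e).
      rewrite ler_pdivlMr// -enorm_sqr eE.
      by rewrite ler_sqr ?nnegrE ?enorm_ge0 ?(ltW d0).
    have := uB x; have := wB y; rewrite !ler_norml /doubled => /andP[_ h1] /andP[_ h2].
    by move: M4 h1 h2 => *; lra.
  have [Dx|nDx] := pselect (D x).
    have nDy : ~ D y by move=> Dy; exact: nD.
    have := ud x y xyd; have := uw0 y nDy; rewrite /doubled ltr_norml => h /andP[_ h'].
    by lra.
  have := wd x y xyd; have := uw0 x nDx; rewrite /doubled ltr_norml => h /andP[h' _].
  by lra.
have diag : doubled u w e x1 x1 = M.
  by rewrite /doubled subrr -enorm_sqr enorm0 expr0n mul0r subr0.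
have [|x0 [y0 [Dx0 Dy0 dmax]]] := @doubled_max u w D e x1
    (unif_continuous_continuous ucu) (unif_continuous_continuous ucw) bD Dx1.
  by move=> x y /off; rewrite diag => /le_lt_trans; apply; lra.
pose p := e^-1 *: (x0 - y0); pose k := (2 * e)^-1; pose K := e^-1.
have kK : k < K by rewrite ltf_pV2 ?posrE ?mulr_gt0//; lra.
have K0 : 0 < K by rewrite invr_gt0.
have utouch z : u (x0 + z) - u x0 <= inner p z + k * enorm z ^+ 2.
  have := doubled_increment (dmax (x0 + z) y0); rewrite subrr addr0 => /le_trans; apply.
  rewrite (_ : x0 + z - y0 = (x0 - y0) + z); last by rewrite addrAC.
  rewrite /p /k enorm_sqr; move: (x0 - y0) => q; rewrite !innerE (innerC z q).
  by rewrite le_eqVlt; apply/orP; left; apply/eqP; field; rewrite gt_eqF.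
have wtouch z : w (y0 + z) - w y0 <= inner (- p) z + k * enorm z ^+ 2.
  have := doubled_increment (dmax x0 (y0 + z)); rewrite subrr add0r => /le_trans; apply.
  rewrite (_ : x0 - (y0 + z) = (x0 - y0) - z); last by rewrite opprD addrA.
  rewrite /p /k enorm_sqr; move: (x0 - y0) => q; rewrite !innerE (innerC z q).
  by rewrite le_eqVlt; apply/orP; left; apply/eqP; field; rewrite gt_eqF.
have [b b0 Db] := bounded_set_enorm bD.
(* Two points of D are at distance at most 2b: farther than [rho] from x0 and y0 the
   increments leave D. *)
pose rho := 2 * b; have rho0 : 0 < rho by rewrite mulr_gt0.
have out x z : D x -> rho < enorm z -> ~ D (x + z).
  move=> Dx rz /Db; rewrite addrC; have := enormB_ge z x; have := Db x Dx.
  by rewrite /rho in rz; lra.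
have [C C0 near_le] := @cone_int_sqr_eball_le R N s alpha s01 ha.
have [c c0 tail_ge] := @cone_int_tail_ge R N s alpha s01 ha rho N0 rho0.
pose delta := M / 4 * c; have delta0 : 0 < delta by rewrite mulr_gt0.
have [r [r0 rrho rdelta]] : exists r, [/\ 0 < r, r <= rho &
    2 * K * (C * r `^ (2 - 2 * s)) <= delta].
  have s2 : 0 < 2 - 2 * s by case/andP: s01; lra.
  have KC0 : 0 < 2 * K * C by rewrite !mulr_gt0.
  have t0 : 0 < delta / (2 * K * C) by rewrite divr_gt0.
  have : \forall r \near 0^'+, r `^ (2 - 2 * s) < delta / (2 * K * C).
    have := @powR_cvg0 R _ s2 => /cvgrPdist_lt /(_ _ t0); apply: filterS => r.
    by rewrite sub0r normrN ger0_norm ?powR_ge0.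
  move=> near_r; near (0 : R)^'+ => r; exists r; split.
  - by near: r; exact: nbhs_right_gt.
  - by near: r; exact: nbhs_right_le.
  - rewrite mulrA mulrC -ler_pdivlMr//; apply: ltW; near: r; exact: near_r.
pose hu z := u (x0 + z) - u x0; pose hw z := w (y0 + z) - w y0.
have bhu : bounded_measurable hu by exact: bounded_measurable_incr.
have bhw : bounded_measurable hw by exact: bounded_measurable_incr.
pose gu := paraboloid_incr p K r hu; pose gw := paraboloid_incr (- p) K r hw.
have [U LU UE] := subsolution_paraboloid subu Dx0 r0 kK utouch.
have [W LW WE] := subsolution_paraboloid subw Dy0 r0 kK wtouch.
have [yu yu1 near_u] := Lop_ge0_near s01 ha hrot r0 UE bhu LU delta0.
have [yw yw1 near_w] := Lop_ge0_near s01 ha hrot r0 WE bhw LW delta0.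
have bgu : bounded_measurable gu by exact: bounded_measurable_paraboloid.
have bgw : bounded_measurable gw by exact: bounded_measurable_paraboloid.
(* The first-order terms of the two test functions cancel. *)
have g_le z : gu z + gw z <=
    2 * K * (enorm z ^+ 2 * \1_(eball r) z) + - (M / 2) * (1 - \1_(eball rho) z).
  have shift_diff : x0 + z - (y0 + z) = x0 - y0 by rewrite opprD addrACA subrr addr0.
  rewrite /gu /gw /paraboloid_incr !indic_eball innerNl.
  have [zr|rz] := leP (enorm z) r.
    by rewrite (le_trans zr rrho) le_eqVlt; apply/orP; left; apply/eqP; ring.
  have := doubled_increment (dmax (x0 + z) (y0 + z)).
  rewrite shift_diff subrr mul0r -/(hu z) -/(hw z) => h0.
  have [zrho|rhoz] := leP (enorm z) rho; first by lra.
  have far : doubled u w e (x0 + z) (y0 + z) <= M / 4.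
    by apply: off => -[+ _]; exact: out.
  have := dmax x1 x1; rewrite diag => h1.
  have : hu z + hw z <= - (M / 2).
    move: far h1; rewrite /doubled /hu /hw shift_diff; lra.
  by lra.
have sum_le y eps : usphere y -> 0 < eps <= rho -> J gu y eps + J gw y eps <= - delta.
  move=> y1 er; have /andP[ep0 _] := er.
  rewrite -cone_intD//.
  have bs := @bounded_measurable_sqr_eball R N r.
  have bt : bounded_measurable (fun z => 1 - \1_(eball rho) z : R).
    split; first by apply: measurable_funB => //; apply: measurable_indic; exact: measurable_eball.
    exists 1 => z; rewrite indic_eball; case: ifP => _; first by rewrite subrr normr0.
    by rewrite subr0 normr1.
  apply: (@le_trans _ _ (J (fun z => 2 * K * (enorm z ^+ 2 * \1_(eball r) z) +
      - (M / 2) * (1 - \1_(eball rho) z)) y eps)).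
    apply: le_cone_int => //; first exact: bounded_measurableD.
    by apply: bounded_measurableD; exact: bounded_measurableZ.
  rewrite cone_intD//; try exact: bounded_measurableZ.
  rewrite !cone_intZ//.
  have h1 := near_le r y eps r0 y1 ep0; have h2 := tail_ge y eps y1 er.
  have h3 : 2 * K * J (fun z => enorm z ^+ 2 * \1_(eball r) z) y eps <= delta.
    by apply: le_trans rdelta; rewrite ler_wpM2l// mulr_ge0// ltW.
  have h4 : M / 2 * c <= M / 2 * J (fun z => 1 - \1_(eball rho) z) y eps.
    by rewrite ler_wpM2l// divr_ge0// ltW.
  by rewrite /delta in h3 *; lra.
have nu := near_u yw yw1; have nw := near_w yu yu1.
near (0 : R)^'+ => eps.
have er : 0 < eps <= rho.
  by apply/andP; split; near: eps; [exact: nbhs_right_gt|exact: nbhs_right_le].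
have : - delta < J gu yu eps + J gu yw eps by near: eps; exact: nu.
have : - delta < J gw yw eps + J gw yu eps by near: eps; exact: nw.
have := sum_le yu eps yu1 er; have := sum_le yw eps yw1 er.
lra.
Unshelve. all: by end_near. Qed.

End comparison.

Theorem corollaryA4 (R : realType) (N : nat) (p s alpha : R)
    (rot : 'rV[R]_N -> 'rV[R]_N -> 'M[R]_N)
    (D : set 'rV[R]_N) (F : 'rV[R]_N -> R) :
  (2 <= N)%N -> 2 <= p -> 1 / 2 < s < 1 ->
  is_cone_angle N p alpha -> is_rotation_family rot ->
  open D -> bounded_set D ->
  bounded_fun F -> unif_continuous F ->
  forall u v : 'rV[R]_N -> R,
    viscosity_solution s alpha rot D F u ->
    viscosity_solution s alpha rot D F v ->
    u = v.
Proof.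
move=> N2 _ /andP[s0 s1] [ha _] hrot _ bD _ _ u v [subu supu uF] [subv supv vF].
have N0 : (0 < N)%N by exact: leq_trans N2.
have s01 : 0 < s < 1 by rewrite s1 andbT; lra.
apply/funext => x; apply/eqP; rewrite eq_le -subr_le0 -[v x <= _]subr_le0.
apply/andP; split.
  apply: (comparison N0 s01 ha hrot bD subu supv) => y nDy /=.
  by rewrite fctE uF// vF// subrr.
apply: (comparison N0 s01 ha hrot bD subv supu) => y nDy /=.
by rewrite fctE uF// vF// subrr.
Qed.
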